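(* Let $N\ge 1$ be an integer and let $p,b,q$ be real numbers with $$1<p<N,\qquad -1\le b\le 0,\qquad q>q^{\ast}=\frac{Np}{N-p-pb}>1.$$ Then there is a positive Schwarz symmetric ground state solution $u$ of the $p$-Laplace Hardy equation $$\Delta_p u+\mu_{qb}\,u^{q-1}=0\quad\text{on }\mathbb{Z}^N,\qquad u\in D_0^{1,p}(\mathbb{Z}^N).$$
   Context: $\mathbb{Z}^N$ denotes the integer lattice graph: the vertices are the points of $\mathbb{Z}^N$, and $x\sim y$ (neighbors) iff $\sum_{i=1}^N|x_i-y_i|=1$. Let $d(x)$ be the combinatorial (graph) distance from $x$ to the origin. For $s\in\mathbb{R}$ define $\mu_s(x)=(1+d(x))^s$. The discrete $p$-Laplacian is $\Delta_p u(x)=\sum_{y\sim x}|u(y)-u(x)|^{p-2}(u(y)-u(x))$. For a function $u$ on $\mathbb{Z}^N$, $\|u\|_{\ell_b^q}=\big(\sum_{x}\mu_{bq}(x)|u(x)|^q\big)^{1/q}$ and $\|u\|_{D^{1,p}}=\big(\sum_{x}\sum_{y\sim x}|u(y)-u(x)|^p\big)^{1/p}$; $D_0^{1,p}(\mathbb{Z}^N)$ is the completion of the finitely supported functions in the norm $\|\cdot\|_{D^{1,p}}$. Ground state solution: a solution that is, up to a positive multiplicative constant, a minimizer of $S=\inf\{\|u\|_{D^{1,p}}^p: u\in D_0^{1,p}(\mathbb{Z}^N),\ \|u\|_{\ell_b^q}=1\}$. Discrete Schwarz rearrangement. Let $C_0^+(\mathbb{Z}^N)$ be the set of non-negative functions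 $u$ on $\mathbb{Z}^N$ with $|\{x:u(x)>t\}|<\infty$ for all $t>0$ (similarly $C_0^+(\mathbb{Z})$, $C_0^+(\mathbb{Z}+\frac12)$). (1) For $f\in C_0^+(\mathbb{Z})$ or $C_0^+(\mathbb{Z}+\frac12)$ with values listed in decreasing order with multiplicity $f_1\ge f_2\ge\cdots$, let $f^\star(x)=f_{1-2x}$ for $x\le 0$ and $f^\star(x)=f_{2x}$ for $x>0$. (2) Let $e_i$ be the standard unit vectors and $\vec E=\{e_i,\frac{e_i-e_j}{2},\frac{e_i+e_j}{2}:1\le i<j\le N\}$. For $e\in\vec E$, partition $\mathbb{Z}^N$ into classes $V_e^\alpha$, where $x,y$ are in the same class iff $x-y$ is parallel to $e$. On each class the map $x\mapsto\langle e,x\rangle$ is a bijection onto $\mathbb{Z}$ or $\mathbb{Z}+\frac12$; via this identification define $R_eu$ by $(R_eu)|_{V_e^\alpha}=(u|_{V_e^\alpha})^\star$ for each $\alpha$. (3) Let $R^k$ be the composition of the first $k$ terms in the periodic sequence of one-step rearrangements $R_{e_1},R_{e_2},\dots,R_{\frac{e_1-e_2}{2}},\dots,R_{\frac{e_1+e_2}{2}},\dots,R_{e_1},\dots$ (cycling through all $e\in\vec E$ in a fixed order, first applied first). For $u\in C_0^+(\mathbb{Z}^N)$, $u^\star(x)=\lim_{k\to\infty}R^ku(x)$; this limit exists. A function $u\in C_0^+(\mathbb{Z}^N)$ is called Schwarz symmetric if $u=u^\star$. *)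

(* Defs.v *)
From HB Require Import structures.
From mathcomp Require Import all_boot all_order all_algebra.
From mathcomp Require Import all_classical all_reals all_analysis.

Set Implicit Arguments.
Unset Strict Implicit.
Unset Printing Implicit Defensive.

Import Order.TTheory GRing.Theory Num.Theory numFieldNormedType.Exports.

Local Open Scope classical_set_scope.
Local Open Scope ring_scope.

Notation lattice N := 'rV[int]_N.

Definition neighbor (N : nat) : rel (lattice N) :=
  fun x y => \sum_(i < N) `|x 0 i - y 0 i| == 1.

Definition neighbors (N : nat) (x : lattice N) : set (lattice N) :=
  [set y | neighbor x y].

Definition walk (N : nat) (x y : lattice N) (n : nat) : Prop :=
  exists s : seq (lattice N), [/\ path (@neighbor N) x s, last x s = y & size s = n].

(* The lattice graph is connected, so the default value of [xget] is never used. *)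
Definition graph_dist (N : nat) (x y : lattice N) : nat :=
  xget 0%N [set n | walk x y n /\ forall m, walk x y m -> (n <= m)%N].

Section Defs.
Variable R : realType.

Definition mu (N : nat) (s : R) (x : lattice N) : R :=
  (1 + (graph_dist x 0)%:R) `^ s.

(* For p < 2 the power |0|^(p-2) is 0 here, so equal values contribute 0. *)
Definition plaplacian (N : nat) (p : R) (u : lattice N -> R) (x : lattice N) : R :=
  \sum_(y \in neighbors x) `|u y - u x| `^ (p - 2) * (u y - u x).

Definition lnorm (N : nat) (b q : R) (u : lattice N -> R) : \bar R :=
  ((\esum_(x in [set: lattice N]) (mu (b * q) x * `|u x| `^ q)%:E) `^ q^-1)%E.

Definition dnorm (N : nat) (p : R) (u : lattice N -> R) : \bar R :=
  ((\esum_(x in [set: lattice N])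
      (\sum_(y \in neighbors x) `|u y - u x| `^ p)%:E) `^ p^-1)%E.

Definition finitely_supported (N : nat) (w : lattice N -> R) : Prop :=
  finite_set [set x | w x != 0].

(* The completion of the finitely supported functions, realized as a space of
   functions: [dnorm] does not see additive constants, and for p < N sequences
   that are Cauchy for [dnorm] converge pointwise (Sobolev inequality), so the
   element of the completion is identified with the pointwise limit. *)
Definition D0 (N : nat) (p : R) (u : lattice N -> R) : Prop :=
  exists w : nat -> lattice N -> R,
    [/\ forall n, finitely_supported (w n),
        forall x, w n x @[n --> \oo] --> u x
      & dnorm p (fun x => w n x - u x) @[n --> \oo] --> 0%E].

Definition admissible (N : nat) (p b q : R) (u : lattice N -> R) : Prop :=
  D0 p u /\ lnorm b q u = 1%E.

Definition S_inf (N : nat) (p b q : R) : \bar R :=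
  ereal_inf [set (dnorm p u `^ p)%E | u in @admissible N p b q].

Definition minimizer (N : nat) (p b q : R) (v : lattice N -> R) : Prop :=
  admissible p b q v /\ (dnorm p v `^ p)%E = S_inf N p b q.

Definition solution (N : nat) (p b q : R) (u : lattice N -> R) : Prop :=
  D0 p u /\ forall x, plaplacian p u x + mu (q * b) x * u x `^ (q - 1) = 0.

Definition ground_state_solution (N : nat) (p b q : R) (u : lattice N -> R) : Prop :=
  solution p b q u /\
  exists2 c : R, 0 < c &
    exists2 v : lattice N -> R, minimizer p b q v & forall x, u x = c * v x.

Definition C0plus (N : nat) (u : lattice N -> R) : Prop :=
  (forall x, 0 <= u x) /\ forall t, 0 < t -> finite_set [set x | t < u x].

(* [g] lists, in decreasing order and with multiplicity, the values of [f] on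
   [V]: all the positive ones, padded with zeros if there are finitely many. *)
Definition lists_decreasing (T : Type) (V : set T) (f : T -> R) (g : nat -> R) : Prop :=
  [/\ forall k, 0 <= g k,
      forall m n, (m <= n)%N -> g n <= g m
    & forall v, 0 < v -> ([set k | g k = v] #= V `&` [set x | f x = v])%card].

(* f_k for k >= 1; if every set {f > t} with t > 0 is finite, the listing exists and
   is unique, so [xget] involves no actual choice. *)
Definition kth_value (T : Type) (V : set T) (f : T -> R) (k : nat) : R :=
  xget (fun=> 0) [set g | lists_decreasing V f g] k.-1.

(* f^star for a function [f] on [V], where [pos] identifies [V] with Z or Z + 1/2;
   the argument of [truncn] is then a positive integer. *)
Definition star (T : Type) (V : set T) (pos : T -> R) (f : T -> R) (x : T) : R :=
  kth_value V f
    (Num.truncn (if pos x <= 0 then 1 - 2 * pos x else 2 * pos x)).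

Definition embed (N : nat) (x : lattice N) : 'rV[R]_N := map_mx intr x.

Definition inner (N : nat) (e x : 'rV[R]_N) : R := \sum_(i < N) e 0 i * x 0 i.

Definition basis_vec (N : nat) (i : 'I_N) : 'rV[R]_N := delta_mx 0 i.

Definition directions (N : nat) : seq 'rV[R]_N :=
  let pairs := [seq ij : 'I_N * 'I_N <- [seq (i, j) | i <- enum 'I_N, j <- enum 'I_N]
               | (ij.1 < ij.2)%N] in
  [seq basis_vec i | i <- enum 'I_N]
  ++ [seq 2^-1 *: (basis_vec ij.1 - basis_vec ij.2) | ij <- pairs]
  ++ [seq 2^-1 *: (basis_vec ij.1 + basis_vec ij.2) | ij <- pairs].

Definition line_class (N : nat) (e : 'rV[R]_N) (x : lattice N) : set (lattice N) :=
  [set y | exists t : R, embed x - embed y = t *: e].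

Definition one_step (N : nat) (e : 'rV[R]_N) (u : lattice N -> R) : lattice N -> R :=
  fun x => star (line_class e x) (fun y => inner e (embed y)) u x.

Fixpoint iter_rearr (N k : nat) (u : lattice N -> R) : lattice N -> R :=
  if k is k'.+1 then
    one_step (nth 0 (directions N) (k' %% size (directions N))) (iter_rearr k' u)
  else u.

Definition schwarz_rearr (N : nat) (u : lattice N -> R) : lattice N -> R :=
  fun x => limn (fun k => iter_rearr k u x).

Definition schwarz_symmetric (N : nat) (u : lattice N -> R) : Prop :=
  C0plus u /\ u = schwarz_rearr u.

Definition qstar (N : nat) (p b : R) : R := N%:R * p / (N%:R - p - p * b).

End Defs.

(* Main.v *)
Require Import Defs.
From mathcomp Require Import all_boot all_order all_algebra finmap.
From mathcomp Require Import all_classical all_reals all_analysis.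
From mathcomp Require Import ring lra zify.
Import Order.TTheory GRing.Theory Num.Theory numFieldNormedType.Exports.

Set Implicit Arguments.
Unset Strict Implicit.
Unset Printing Implicit Defensive.
Local Open Scope classical_set_scope.
Local Open Scope ring_scope.

(** The solution is a multiple of a minimizer of the energy
    sum_(x, y ~ x) |u y - u x|^p under the constraint that the mass
    sum_x mu_(b q)(x) |u x|^q is 1. Minimizing sequences are made compact by
    symmetrization, and the minimizer inherits their symmetry.

    Symmetrization is done with two-point rearrangements. On every line directed
    by e_i or e_i +- e_j the one-step rearrangement sorts the values in one fixed order of
    the points of the line. The reflections that exchange two points of such a line are
    automorphisms of the lattice graph, and polarizing a function, which puts the
    larger of the values at two mirror images at the preferred point, does not increase the
    energy ([energy_polarize]) and does not decrease the mass ([mass_polarize]).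
    The orders of all lines are induced by a single function, the squared distance
    to a suitable point near the origin ([psi_lt]); therefore polarizing a
    finitely supported function repeatedly terminates ([symmetrize]) with a
    function which is sorted along every line, called aligned below.

    The values of an aligned function are at most those in a whole cube of
    comparable radius ([aligned_dominated]). Averaging differences over translates
    of cubes and summing over dyadic scales gives the pointwise decay
      u x <= C (energy u)^(1/p) (1 + d x)^(1 - N/p)
    ([decay_pointwise]). The hypothesis q > qstar says precisely that the weight
    times the q-th power of this profile is summable ([exponent_gap]). Hence, along a
    minimizing sequence of aligned functions, pointwise limits lose no mass, and the
    energy is lower semicontinuous ([limit_profile]). Truncation shows that the
    limit belongs to the completion ([D0_vanishing]), and approximating an arbitrary
    admissible function by finitely supported ones, then symmetrizing these, shows that the
    limit, once normalized, is a minimizer ([compare], [exists_minimizer]).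

    Varying the minimizer at one point yields the equation up to a constant
    factor ([euler_lagrange]), which scaling removes as p < q; a zero of the solution
    would propagate to the neighbors ([solution_gt0]). Alignment is an inequality
    between pairs of values, so it passes to the limit; and an aligned function
    vanishing at infinity is fixed by all one-step rearrangements, hence equal to
    its Schwarz rearrangement ([schwarz_symmetric_aligned]). *)

(** * Lattice lines, reflections and the graph distance *)

Section Lattice.
Variable N : nat.
Implicit Types (a x y z : lattice N) (m c s t : int).

Definition dot a x : int := \sum_(i < N) a 0 i * x 0 i.

Lemma dotC a x : dot a x = dot x a.
Proof. by apply: eq_bigr => i _; rewrite mulrC. Qed.

Lemma dotDr a x y : dot a (x + y) = dot a x + dot a y.
Proof. by rewrite -big_split; apply: eq_bigr => i _; rewrite mxE mulrDr. Qed.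

Lemma dotDl a x y : dot (x + y) a = dot x a + dot y a.
Proof. by rewrite dotC dotDr !(dotC a). Qed.

Lemma dotZr a c x : dot a (c *: x) = c * dot a x.
Proof. by rewrite mulr_sumr; apply: eq_bigr => i _; rewrite mxE mulrCA. Qed.

Lemma dotZl a c x : dot (c *: x) a = c * dot x a.
Proof. by rewrite dotC dotZr dotC. Qed.

Lemma dotNr a x : dot a (- x) = - dot a x.
Proof. by rewrite -scaleN1r dotZr mulN1r. Qed.

Lemma dotNl a x : dot (- x) a = - dot x a.
Proof. by rewrite dotC dotNr dotC. Qed.

Definition dotE := (dotDl, dotDr, dotNl, dotNr, dotZl, dotZr).

Lemma dot_deltal (i : 'I_N) x : dot (delta_mx 0 i) x = x 0 i.
Proof.
rewrite /dot (bigD1 i)//= big1 => [|j ji]; rewrite mxE ?eqxx ?mul1r ?addr0//.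
by rewrite (negbTE ji) andbF mul0r.
Qed.

Lemma dot_ge0 x : 0 <= dot x x.
Proof. by apply: sumr_ge0 => i _; rewrite -expr2 sqr_ge0. Qed.

Lemma dot_eq0 x : dot x x = 0 -> x = 0.
Proof.
move/eqP; rewrite psumr_eq0 => [/allP h|i _]; last by rewrite -expr2 sqr_ge0.
apply/rowP => i; rewrite mxE; have := h i (mem_index_enum _).
by rewrite /= mulf_eq0 orbb => /eqP.
Qed.

Definition l1 x : int := \sum_(i < N) `|x 0 i|.

Lemma sum_int_eq1 (f : 'I_N -> int) i :
  (forall j, 0 <= f j) -> \sum_j f j = 1 -> f i <= 1.
Proof. by move=> f0 <-; rewrite (bigD1 i)//= lerDl sumr_ge0. Qed.

(** An integer vector is a unit vector for the l1 norm iff it is one for the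
    Euclidean norm. Adjacency thus becomes a Euclidean notion, which orthogonal
    maps obviously preserve. *)
Lemma l1_dot x : (l1 x == 1) = (dot x x == 1).
Proof.
have sq (k : int) : `|k| <= 1 -> `|k| = k * k.
  by move=> k1; have [->|[->|->]] : k = 0 \/ k = 1 \/ k = -1 by lia.
apply/idP/idP => /eqP h; apply/eqP; rewrite -[RHS]h; apply: eq_bigr => i _.
  by rewrite [RHS]sq// (@sum_int_eq1 (fun i => `|x 0 i|)).
apply: sq.
have : x 0 i * x 0 i <= 1.
  by apply: (@sum_int_eq1 (fun i => x 0 i * x 0 i)) => // j; rewrite -expr2 sqr_ge0.
nia.
Qed.

Lemma neighborE x y : neighbor x y = (dot (y - x) (y - x) == 1).
Proof.
rewrite -l1_dot /neighbor; congr (_ == _); apply: eq_bigr => i _.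
by rewrite !mxE distrC.
Qed.

Lemma neighborC x y : neighbor x y = neighbor y x.
Proof. by rewrite !neighborE -[y - x]opprB dotNl dotNr opprK. Qed.

(** Up to the factor 1/2 these are the directions of the one-step
    rearrangements; as lattice vectors they generate the lines on which those
    rearrangements act. *)
Definition axis a : Prop :=
  [\/ exists i : 'I_N, a = delta_mx 0 i,
      exists i j : 'I_N, (i < j)%N /\ a = delta_mx 0 i - delta_mx 0 j
    | exists i j : 'I_N, (i < j)%N /\ a = delta_mx 0 i + delta_mx 0 j].

Lemma ltn_ord_neq (i j : 'I_N) : (i < j)%N -> (i == j = false) * (j == i = false).
Proof. by move=> ij; rewrite -!val_eqE/= (ltn_eqF ij) (gtn_eqF ij). Qed.

Lemma axis_norm a : axis a -> dot a a = 1 \/ dot a a = 2.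
Proof.
move=> [[i ->]|[i [j [/ltn_ord_neq ij ->]]]|[i [j [/ltn_ord_neq ij ->]]]];
  rewrite ?dotE ?dot_deltal !mxE !eqxx ?ij; [left|right|right] => //=; lia.
Qed.

Lemma dot_eq1 a x : axis a -> dot x x = 1 -> -1 <= dot a x <= 1.
Proof.
move=> /axis_norm ha hx.
have := dot_ge0 (x - a); have := dot_ge0 (x + a).
rewrite !dotE (dotC x a) hx.
by case: ha => ->; lia.
Qed.

(** The rearrangement on a line fills the positions 0, 1, -1, 2, -2, and so on,
    respectively 1/2, -1/2, 3/2, and so on: in both cases, the order of the
    distance of the position to 1/4. Here [s] is the inner product with the axis:
    the position if the axis has one nonzero entry, and twice the position if it
    has two. In the second case the order is that of |s - 1/2|, but as the parity of
    [s] is then constant on the line, |s - 1/4| gives the same order. *)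
Definition key s : int := `|4 * s - 1|.

Lemma key_inj : injective key.
Proof. by rewrite /key => s t; lia. Qed.

(** Orthogonal reflection in the hyperplane <a, x> = m <a, a> / 2; the factor of
    [dot a x] is 2 / <a, a>. As [m] varies, these maps exchange any two points of a
    line directed by [a]. *)
Definition refl a m x := x + (m - (if dot a a == 1 then 2 else 1) * dot a x) *: a.

Lemma dot_refl a m x : axis a -> dot a (refl a m x) = m * dot a a - dot a x.
Proof. by move=> /axis_norm[] h; rewrite /refl !dotE h/=; ring. Qed.

Lemma reflK a m : axis a -> involutive (refl a m).
Proof.
move=> ra x; rewrite {1}/refl dot_refl// {1}/refl -addrA -scalerDl.
rewrite -[RHS]addr0 -(scale0r a); congr (_ + _ *: _).
by case: (axis_norm ra) => -> /=; ring.
Qed.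

Lemma neighbor_refl a m x y : axis a ->
  neighbor (refl a m x) (refl a m y) = neighbor x y.
Proof.
move=> ra; rewrite !neighborE.
have -> : refl a m y - refl a m x =
    (y - x) - ((if dot a a == 1 then 2 else 1) * dot a (y - x)) *: a.
  by rewrite /refl; apply/rowP => i; rewrite !mxE !dotE; ring.
move: (y - x) => d; rewrite !dotE (dotC d a).
by case: (axis_norm ra) => -> /=; congr (_ == _); ring.
Qed.

(** The combinatorial reason why polarization does not increase the energy: an
    edge joining the two open sides of the mirror joins two mirror images. The
    integer 2 <a, x> - m <a, a>, whose sign tells the side, changes by at most 2 along
    an edge; to change sign it must go from 1 to -1 or back, which only happens when
    the edge is parallel to an axis of norm 1. *)
Lemma refl_crossing a m x y : axis a -> neighbor x y ->
  key (dot a x) < key (dot a (refl a m x)) ->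
  key (dot a (refl a m y)) < key (dot a y) -> y = refl a m x.
Proof.
move=> ra; rewrite neighborE => /eqP d1; rewrite !dot_refl// => kx ky.
apply/eqP; rewrite -subr_eq0; apply/eqP/dot_eq0.
have -> : y - refl a m x = (y - x) - (m - (if dot a a == 1 then 2 else 1) * dot a x) *: a.
  by rewrite /refl opprD addrA.
have := dot_eq1 ra d1.
have : dot a y = dot a (y - x) + dot a x by rewrite !dotE; ring.
move: (y - x) d1 => d d1.
have -> k : dot (d - k *: a) (d - k *: a) = 1 - 2 * k * dot a d + k * k * dot a a.
  by rewrite !dotE (dotC d a) d1; ring.
move: kx ky; move: (dot a d) (dot a x) (dot a y) => e s t.
rewrite /key; case: (axis_norm ra) => ->; last by move=> /= *; lia.
move=> /= kx ky et e1.
have [[-> ->]|[-> ->]] : m = 2 * s + e /\ e = 1 \/ m = 2 * s + e /\ e = -1.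
- by lia.
- by ring.
- by ring.
Qed.

Lemma key_lt_prod s t : (key s < key t) = (0 < (t - s) * (2 * (s + t) - 1)).
Proof. by rewrite /key; nia. Qed.

(** With z = centre / (2 N + 1) one has 1/2 > z_1 > ... > z_N > 0, so that on
    every line directed by an axis the point nearest to z has a position strictly
    between 0 and 1/2; the distance to any such point sorts the positions in the
    same order as the distance to 1/4. *)
Definition centre : lattice N := \row_i (N - i)%:Z.

(** The squared distance to z, scaled by (2 N + 1)^2: one function on the whole
    lattice which orders every line as the rearrangement does. *)
Definition psi x : int :=
  dot ((2 * N + 1)%:Z *: x - centre) ((2 * N + 1)%:Z *: x - centre).

Lemma psi_ge0 x : 0 <= psi x.
Proof. exact: dot_ge0. Qed.

Lemma axis_centre a : axis a -> 0 < 2 * dot a centre < (2 * N + 1)%:Z * dot a a.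
Proof.
move=> [[i ->]|[i [j [ij ->]]]|[i [j [ij ->]]]];
  rewrite ?dotE ?dot_deltal !mxE !eqxx ?(ltn_ord_neq ij)/=.
- by have := ltn_ord i; lia.
- by have := ltn_ord j; lia.
- by have := ltn_ord i; have := ltn_ord j; lia.
Qed.

Lemma psi_lt a x c : axis a -> key (dot a x) < key (dot a (x + c *: a)) ->
  psi x < psi (x + c *: a).
Proof.
move=> ra.
have := axis_centre ra; set M := (2 * N + 1)%:Z.
have M0 : 0 < M by rewrite /M; lia.
rewrite key_lt_prod -[psi x < _]subr_gt0 /psi -/M.
have -> : dot (M *: (x + c *: a) - centre) (M *: (x + c *: a) - centre) -
    dot (M *: x - centre) (M *: x - centre) =
    M * (c * (M * (2 * dot a x + c * dot a a) - 2 * dot a centre)).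
  by rewrite !dotE (dotC x a) (dotC centre a) (dotC centre x); ring.
rewrite dotDr dotZr; move: (dot a centre) (dot a x) => v s.
rewrite addrAC subrr add0r; move: (dot a a) (axis_norm ra) => n n2.
have n0 : 0 < n by case: n2 => ->.
case: (ltgtP c 0) => [c0|c0|->]; last by rewrite !mul0r.
- move=> v0; rewrite -mulrA [0 < M * _]pmulr_rgt0// !nmulr_rgt0// => h.
  have {}h : 2 * (s + (s + c * n)) - 1 < 0 by rewrite ltNge; apply/negP => ?; nia.
  have : 2 * s + c * n <= 0 by lia.
  by nia.
- move=> v0; rewrite -mulrA !pmulr_rgt0// => h.
  have : n <= 2 * s + c * n by case: n2 h => ->; nia.
  by nia.
Qed.

Lemma l1_D1 (i : 'I_N) x : l1 x = `|x 0 i| + \sum_(k | k != i) `|x 0 k|.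
Proof. by rewrite /l1 (bigD1 i). Qed.

(** Along a line the l1 norm is a convex function of the position, symmetric
    about 0, hence nondecreasing in the order of [key]. *)
Lemma l1_le a x c : axis a -> key (dot a x) < key (dot a (x + c *: a)) ->
  l1 x <= l1 (x + c *: a).
Proof.
move=> ra; rewrite /key.
case: ra => [[i ->]|[i [j [ij ->]]]|[i [j [ij ->]]]].
- rewrite !dotE !dot_deltal !mxE !eqxx !(l1_D1 i) !mxE !eqxx /= !mulr1 => h.
  apply: lerD; first by lia.
  by apply: ler_sum => k ki; rewrite !mxE (negbTE ki) andbF mulr0 addr0.
-  rewrite !dotE !dot_deltal !mxE !eqxx !(ltn_ord_neq ij)/= !(l1_D1 i).
  rewrite !(bigD1 (P := fun k => k != i) j)/= ?(ltn_ord_neq ij)//.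
  rewrite !mxE !eqxx !(ltn_ord_neq ij)/= => h.
  rewrite !addrA; apply: lerD; first by lia.
  by apply: ler_sum => k /andP[ki kj]; rewrite !mxE (negbTE ki) (negbTE kj) subr0 mulr0 addr0.
-  rewrite !dotE !dot_deltal !mxE !eqxx !(ltn_ord_neq ij)/= !(l1_D1 i).
  rewrite !(bigD1 (P := fun k => k != i) j)/= ?(ltn_ord_neq ij)//.
  rewrite !mxE !eqxx !(ltn_ord_neq ij)/= => h.
  rewrite !addrA; apply: lerD; first by lia.
  by apply: ler_sum => k /andP[ki kj]; rewrite !mxE (negbTE ki) (negbTE kj) addr0 mulr0 addr0.
Qed.

Lemma l1_triangle x y : l1 (x + y) <= l1 x + l1 y.
Proof. by rewrite -big_split/=; apply: ler_sum => i _; rewrite mxE ler_normD. Qed.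

Lemma walk_l1 x y n : walk x y n -> l1 (x - y) <= n%:Z.
Proof.
move=> [s [ps <- <-]] {n y}; elim: s x ps => [x _|z s IH x]/=.
  by rewrite subrr /l1 big1// => i _; rewrite mxE normr0.
move=> /andP[xz /IH h]; rewrite -[x - _](subrKA z).
apply: le_trans (l1_triangle _ _) _.
have -> : l1 (x - z) = 1; last by move: (l1 _) h => k; lia.
by move: xz => /eqP xz; rewrite -[RHS]xz; apply: eq_bigr => i _; rewrite !mxE.
Qed.

Lemma l1_walk x n : l1 x = n%:Z -> walk x 0 n.
Proof.
elim: n x => [x h|n IH x h].
  exists [::]; split => //=; apply/rowP => i; rewrite mxE.
  move/eqP: h; rewrite psumr_eq0// => /allP /(_ i (mem_index_enum _)).
  by rewrite normr_eq0 => /eqP.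
have [i xi] : exists i, x 0 i != 0.
  apply/not_existsP => h0; move: h; rewrite /l1 big1// => i _.
  by have /negP := h0 i; rewrite negbK => /eqP ->; rewrite normr0.
pose y := x - Num.sg (x 0 i) *: delta_mx 0 i.
have xy : l1 y = n%:Z.
  have e : \sum_(k | k != i) `|y 0 k| = \sum_(k | k != i) `|x 0 k|.
    by apply: eq_bigr => k ki; rewrite !mxE (negbTE ki) mulr0 subr0.
  move: h; rewrite !(l1_D1 i) {}e !mxE !eqxx.
  by move: xi (\sum_(_ | _) _); case: (sgrP (x 0 i)) => //= ? _ k; lia.
have [s [ps ls ss]] := IH _ xy.
exists (y :: s); split => //=; last by rewrite ss.
rewrite ps andbT neighborE /y addrC addKr !dotE dot_deltal mxE !eqxx.
by move: xi; case: (sgrP (x 0 i)).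
Qed.

Lemma graph_dist_l1 x : (graph_dist x 0)%:Z = l1 x.
Proof.
have l0 : 0 <= l1 x by apply: sumr_ge0.
have e : l1 x = `|l1 x|%N%:Z by lia.
have w := l1_walk e.
rewrite /graph_dist; case: xgetP => [n _ [/walk_l1 h hn]|/(_ `|l1 x|%N) []].
  by move: h (hn _ w); rewrite subr0; lia.
by split => // m /walk_l1; rewrite subr0; lia.
Qed.

Lemma l1_ge x i : `|x 0 i| <= l1 x.
Proof. by rewrite (l1_D1 i) lerDl sumr_ge0. Qed.

Lemma ge_l1 x n : (forall i, `|x 0 i| <= n%:Z) -> l1 x <= (N * n)%:Z.
Proof.
move=> h; apply: (le_trans (ler_sum _ (fun i _ => h i))).
by rewrite sumr_const card_ord; lia.
Qed.

Definition boxfun n (f : {ffun 'I_N -> 'I_n}) : lattice N := \row_i (f i : nat)%:Z.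

Lemma boxfun_inj n : injective (@boxfun n).
Proof.
move=> f g /rowP h; apply/ffunP => i; apply/val_inj.
by have := h i; rewrite !mxE => -[].
Qed.

Lemma finite_box n : finite_set [set x : lattice N | forall i, `|x 0 i| <= n%:Z].
Proof.
apply: (@sub_finite_set _ _ ((fun f => boxfun f - \row_i n%:Z : lattice N) @` [set: {ffun 'I_N -> 'I_(2 * n + 1)}])).
  move=> x /= h.
  have P (i : 'I_N) : (`|(x 0 i + n%:Z)%R| < 2 * n + 1)%N.
    by have := h i; move: (x 0 i) => k; lia.
  exists [ffun i => Ordinal (P i)] => //; apply/rowP => i; rewrite !mxE ffunE/=.
  by have := h i; move: (x 0 i) => k; lia.
exact/finite_image/finite_finset.
Qed.

Lemma finite_ball n : finite_set [set x : lattice N | (graph_dist x 0 <= n)%N].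
Proof.
apply: sub_finite_set (finite_box n) => x /= h i.
by have := l1_ge x i; rewrite -graph_dist_l1; lia.
Qed.

Lemma finite_neighbors x : finite_set (neighbors x).
Proof.
apply: (@sub_finite_set _ _ ((fun z : lattice N => x + z) @` [set z : lattice N | forall i, `|z 0 i| <= 1%:Z])).
  move=> y; rewrite /neighbors/= => /eqP h; exists (y - x); last by rewrite subrKC.
  by move=> i; rewrite !mxE distrC; apply: (@sum_int_eq1 (fun j => `|x 0 j - y 0 j|)).
exact/finite_image/finite_box.
Qed.

End Lattice.

(** * Polarization *)

Section TwoPoint.
Variable R : realType.
Implicit Types (a b c d t p : R).

Lemma norm_powR_convex p t a b : 1 <= p -> 0 <= t <= 1 ->
  `|t * a + (1 - t) * b| `^ p <= t * `|a| `^ p + (1 - t) * `|b| `^ p.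
Proof.
move=> p1 /andP[t0 t1].
have p0 : 0 <= p by lra.
apply: (@le_trans _ _ ((t * `|a| + (1 - t) * `|b|) `^ p)).
  apply: ge0_ler_powR => //; rewrite ?nnegrE//.
    by rewrite addr_ge0// mulr_ge0//; lra.
  apply: le_trans (ler_normD _ _) _.
  by rewrite !normrM (ger0_norm t0) (@ger0_norm _ (1 - t))//; lra.
have t01 : 0 <= t <= 1 by rewrite t0 t1.
have := @convex_powR R p p1 (Itv01 t0 t1) `|a| `|b|.
by apply; rewrite in_setE/= in_itv/= normr_ge0.
Qed.

(** Two numbers are more spread out than two others of the same sum lying
    between them, so a convex function has a larger sum on them. *)
Lemma majorize_powR p s t x y : 1 <= p -> t <= x <= s -> x + y = s + t ->
  `|x| `^ p + `|y| `^ p <= `|s| `^ p + `|t| `^ p.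
Proof.
move=> p1 /andP[tx xs] xy.
have [st|st] := eqVneq s t.
  have ex : x = s by lra.
  have ey : y = t by lra.
  by rewrite ex ey.
have st0 : 0 < s - t by move/eqP: st => st; lra.
pose l := (x - t) / (s - t).
have l01 : 0 <= l <= 1.
  by rewrite /l divr_ge0/= ?ler_pdivrMr ?mul1r//; lra.
have lst : l * (s - t) = x - t by rewrite /l divfK// gt_eqF.
have h1 := norm_powR_convex s t p1 l01.
have l01' : 0 <= 1 - l <= 1 by lra.
have h2 := norm_powR_convex s t p1 l01'.
have e1 : l * s + (1 - l) * t = x by lra.
have e2 : (1 - l) * s + (1 - (1 - l)) * t = y by lra.
rewrite e1 in h1; rewrite e2 in h2.
by move: (`|s| `^ p) (`|t| `^ p) h1 h2 => S T; lra.
Qed.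

Lemma polarize_two_point p a a' b b' : 1 <= p ->
  `|Num.max b b' - Num.max a a'| `^ p + `|Num.min b b' - Num.min a a'| `^ p <=
  `|b - a| `^ p + `|b' - a'| `^ p.
Proof.
move=> p1; case: (leP a a') => aa; case: (leP b b') => bb; rewrite ?lexx//.
- by rewrite addrC.
- have [h|h] := leP (b - a) (b' - a'); first by lra.
  by apply: majorize_powR => //; lra.
- have [h|h] := leP (b' - a') (b - a); first by lra.
  rewrite [leRHS]addrC; apply: majorize_powR => //; lra.
Qed.

End TwoPoint.

Section Sums.
Variables (R : realType) (T : choiceType).
Implicit Types (f g : T -> R).

Lemma esum_leP f (M : R) : (forall x, 0 <= f x) ->
  (\esum_(x in [set: T]) (f x)%:E <= M%:E)%E <->
  (forall X : {fset T}, \sum_(x <- X) f x <= M).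
Proof.
move=> f0; split=> [h X|h].
  rewrite -lee_fin; apply: le_trans h; apply: ereal_sup_ubound.
  exists [set` X]; first by split.
  by rewrite fsbig_finite//= set_fsetK sumEFin.
apply: ge_ereal_sup => _ [F [finF _] <-].
by rewrite fsumEFin// lee_fin fsbig_finite.
Qed.

Lemma esum_inv (s : T -> T) (f : T -> \bar R) : involutive s ->
  \esum_(x in [set: T]) f x = \esum_(x in [set: T]) f (s x).
Proof.
move=> sK; apply: reindex_esum; split => // [x y _ _ /(inv_inj sK)//|y _].
by exists (s y).
Qed.

(** To compare two sums it is enough to compare them on the orbits of an
    involution. *)
Lemma le_esum_inv (s : T -> T) f g : involutive s ->
  (forall x, 0 <= f x) -> (forall x, 0 <= g x) ->
  (forall x, f x + f (s x) <= g x + g (s x)) ->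
  (\esum_(x in [set: T]) (f x)%:E <= \esum_(x in [set: T]) (g x)%:E)%E.
Proof.
move=> sK f0 g0 fg.
have dbl (h : T -> R) : (forall x, 0 <= h x) ->
    (\esum_(x in [set: T]) (h x + h (s x))%:E =
     2%:E * \esum_(x in [set: T]) (h x)%:E)%E.
  move=> h0; rewrite (eq_esum (b := fun x => ((h x)%:E + (h (s x))%:E)%E))//.
  rewrite esumD//; [|by move=> x _; rewrite lee_fin ..].
  by rewrite -(esum_inv (fun x => (h x)%:E) sK) -mule2n mule_natl.
have : (\esum_(x in [set: T]) (f x + f (s x))%:E <=
        \esum_(x in [set: T]) (g x + g (s x))%:E)%E.
  by apply: le_esum => x _; rewrite lee_fin.
by rewrite !dbl// lee_pmul2l// fin_numE.
Qed.

End Sums.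

Section Functionals.
Variables (R : realType) (N : nat).
Implicit Types (u v w : lattice N -> R) (x y z a : lattice N) (m : int) (p b q : R).

Definition dens p u x : R := \sum_(y \in neighbors x) `|u y - u x| `^ p.

Definition energy p u : \bar R := \esum_(x in [set: lattice N]) (dens p u x)%:E.

Definition mass b q u : \bar R :=
  \esum_(x in [set: lattice N]) (mu (b * q) x * `|u x| `^ q)%:E.

Lemma dens_ge0 p u x : 0 <= dens p u x.
Proof. by apply: fsumr_ge0 => y _; rewrite powR_ge0. Qed.

Lemma energy_ge0 p u : (0 <= energy p u)%E.
Proof. by apply: esum_ge0 => x _; rewrite lee_fin dens_ge0. Qed.

Lemma mu_gt0 (s : R) x : 0 < mu s x.
Proof. by apply: powR_gt0; rewrite ltr_pwDl. Qed.

Lemma mass_term_ge0 b q u x : 0 <= mu (b * q) x * `|u x| `^ q.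
Proof. by rewrite mulr_ge0 ?powR_ge0// ltW// mu_gt0. Qed.

Lemma mass_ge0 b q u : (0 <= mass b q u)%E.
Proof. by apply: esum_ge0 => x _; rewrite lee_fin mass_term_ge0. Qed.

Lemma densE p u x : dens p u x = \sum_(y <- fset_set (neighbors x)) `|u y - u x| `^ p.
Proof. by rewrite /dens fsbig_finite//; exact: finite_neighbors. Qed.

Lemma mem_nbhd x y : (y \in fset_set (neighbors x)) = neighbor x y.
Proof.
rewrite in_fset_set; last exact: finite_neighbors.
by apply/idP/idP; rewrite inE.
Qed.

Lemma dens_refl p u a m x : axis a ->
  dens p u (refl a m x) =
  \sum_(y <- fset_set (neighbors x)) `|u (refl a m y) - u (refl a m x)| `^ p.
Proof.
move=> ra; rewrite -(fsbig_finite _ _ (finite_neighbors x)).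
rewrite /dens; apply: reindex_fsbig; split.
- by move=> y; rewrite /neighbors/= neighbor_refl.
- by move=> y z _ _ /(inv_inj (reflK m ra)).
- move=> y h; exists (refl a m y); last by rewrite reflK.
  by move: h; rewrite /neighbors/= -(neighbor_refl m x _ ra) reflK.
Qed.

(** The larger of the two values at mirror images goes to the point that comes
    first on its line. *)
Definition polarize a m u x : R :=
  if key (dot a x) <= key (dot a (refl a m x))
  then Num.max (u x) (u (refl a m x)) else Num.min (u x) (u (refl a m x)).

Lemma key_refl_eq a m x : axis a ->
  key (dot a x) = key (dot a (refl a m x)) -> refl a m x = x.
Proof.
move=> ra /key_inj; rewrite {2}/refl dotDr dotZr.
move=> /eqP; rewrite -subr_eq0 opprD addNKr oppr_eq0 mulf_eq0.
rewrite orbC => /orP[h|/eqP h]; first by case: (axis_norm ra) h => ->.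
by rewrite /refl h scale0r addr0.
Qed.

Lemma polarize_good a m u x : axis a ->
  key (dot a x) <= key (dot a (refl a m x)) ->
  (polarize a m u x = Num.max (u x) (u (refl a m x))) *
  (polarize a m u (refl a m x) = Num.min (u x) (u (refl a m x))).
Proof.
move=> ra h; rewrite /polarize h reflK//; split=> //.
case: leP => h' ; last by rewrite minC.
have -> : refl a m x = x by apply: key_refl_eq => //; apply/eqP; rewrite eq_le h h'.
by rewrite minxx maxxx.
Qed.

Lemma polarize_bad a m u x : axis a ->
  key (dot a (refl a m x)) <= key (dot a x) ->
  (polarize a m u x = Num.min (u x) (u (refl a m x))) *
  (polarize a m u (refl a m x) = Num.max (u x) (u (refl a m x))).
Proof.
move=> ra h; have h' : key (dot a (refl a m x)) <= key (dot a (refl a m (refl a m x))).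
  by rewrite reflK.
have := polarize_good u ra h'; rewrite reflK// => -[-> ->].
by rewrite minC maxC.
Qed.

(** Compare an edge and its mirror image. An edge between mirror images is
    unchanged; otherwise both ends lie on the same closed side by
    [refl_crossing], so both maxima are taken at its ends and both minima at the
    ends of its image, and the two-point inequality applies. *)
Lemma polarize_edge p u a m x y : 1 <= p -> axis a -> neighbor x y ->
  `|polarize a m u y - polarize a m u x| `^ p +
  `|polarize a m u (refl a m y) - polarize a m u (refl a m x)| `^ p <=
  `|u y - u x| `^ p + `|u (refl a m y) - u (refl a m x)| `^ p.
Proof.
move=> p1 ra xy.
have [->|nxy] := eqVneq y (refl a m x).
  rewrite reflK//; have [h|h] := leP (key (dot a x)) (key (dot a (refl a m x))).
    rewrite !(polarize_good u ra h).
    by case: (leP (u x)) => _; rewrite ?lexx// addrC.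
  rewrite !(polarize_bad u ra (ltW h)).
  by case: (leP (u x)) => _; rewrite ?lexx// addrC.
have [hx|hx] := leP (key (dot a x)) (key (dot a (refl a m x)));
  have [hy|hy] := leP (key (dot a y)) (key (dot a (refl a m y))).
- by rewrite !(polarize_good u ra hx) !(polarize_good u ra hy) polarize_two_point.
- move: (hx); rewrite le_eqVlt => /orP[/eqP h|h].
    have h' : key (dot a (refl a m x)) <= key (dot a x) by rewrite h.
    rewrite !(polarize_bad u ra (ltW hy)) !(polarize_bad u ra h').
    by rewrite addrC polarize_two_point.
  by rewrite (refl_crossing ra xy h hy) eqxx in nxy.
- move: (hy); rewrite le_eqVlt => /orP[/eqP h|h].
    have h' : key (dot a (refl a m y)) <= key (dot a y) by rewrite h.
    rewrite !(polarize_bad u ra (ltW hx)) !(polarize_bad u ra h').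
    by rewrite addrC polarize_two_point.
  move: nxy; rewrite neighborC in xy.
  by rewrite [x in refl _ _ x](refl_crossing ra xy h hx) reflK// eqxx.
- rewrite !(polarize_bad u ra (ltW hx)) !(polarize_bad u ra (ltW hy)).
  by rewrite addrC polarize_two_point.
Qed.

Lemma energy_polarize p u a m : 1 <= p -> axis a ->
  (energy p (polarize a m u) <= energy p u)%E.
Proof.
move=> p1 ra; apply: (le_esum_inv (reflK m ra)) => [x|x|x]; rewrite ?dens_ge0//.
rewrite !dens_refl// !densE -!big_split/= big_seq [leRHS]big_seq.
by apply: ler_sum => y; rewrite mem_nbhd => xy; exact: polarize_edge.
Qed.

Lemma mu_refl_le (s : R) a m x : s <= 0 -> axis a ->
  key (dot a x) <= key (dot a (refl a m x)) -> mu s (refl a m x) <= mu s x.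
Proof.
move=> s0 ra; rewrite le_eqVlt => /orP[/eqP/key_refl_eq->//|h].
have := l1_le ra h; rewrite -/(refl a m x) -!graph_dist_l1 => d.
rewrite /mu -[s]opprK !(powRN _ (- s)) lef_pV2 ?posrE ?powR_gt0 ?ltr_pwDl//.
apply: ge0_ler_powR; rewrite ?nnegrE ?oppr_ge0 ?addr_ge0//.
by rewrite lerD2l ler_nat; lia.
Qed.

(** For [b <= 0] the weight decreases with the distance, and polarization moves
    the larger value to the point nearer to the origin. *)
Lemma mass_polarize b q u a m : b <= 0 -> 0 <= q -> axis a -> (forall x, 0 <= u x) ->
  (mass b q u <= mass b q (polarize a m u))%E.
Proof.
move=> b0 q0 ra u0.
have bq : b * q <= 0 by rewrite mulr_le0_ge0.
have st x : key (dot a x) <= key (dot a (refl a m x)) ->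
    mu (b * q) x * `|u x| `^ q + mu (b * q) (refl a m x) * `|u (refl a m x)| `^ q <=
    mu (b * q) x * `|polarize a m u x| `^ q +
    mu (b * q) (refl a m x) * `|polarize a m u (refl a m x)| `^ q.
  move=> h; rewrite !(polarize_good u ra h).
  have muh := mu_refl_le bq ra h.
  case: (leP (u x)) => //= uu.
  have : `|u x| `^ q <= `|u (refl a m x)| `^ q.
    by apply: ge0_ler_powR => //; rewrite ?nnegrE// !ger0_norm.
  by nra.
apply: (le_esum_inv (reflK m ra)) => [x|x|x]; rewrite ?mass_term_ge0//.
have [h|h] := leP (key (dot a x)) (key (dot a (refl a m x))); first exact: st.
rewrite addrC [leRHS]addrC -{2 4}(reflK m ra x).
have := st (refl a m x); rewrite reflK// => st'; apply: st'; exact: ltW.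
Qed.

End Functionals.

(** * Symmetrization by repeated polarization *)

Section Symmetrization.
Variables (R : realType) (N : nat).
Implicit Types (u w : lattice N -> R) (x y z a : lattice N) (m c : int) (p b q : R).

(** The functions sorted along every line: for functions vanishing at infinity
    these are the common fixed points of all one-step rearrangements. Unlike
    fixed points of a limit procedure, they are described by inequalities
    between pairs of values, and so are stable under pointwise limits. *)
Definition aligned u : Prop := forall a x c, axis a ->
  key (dot a x) < key (dot a (x + c *: a)) -> u (x + c *: a) <= u x.

Lemma esum_fsupp (T : choiceType) (f : T -> R) : (forall i, 0 <= f i) ->
  finite_set [set i | f i != 0] ->
  (\esum_(i in [set: T]) (f i)%:E = (\sum_(i \in [set i | f i != 0%R]) f i)%:E)%E.
Proof.
move=> f0 fin.
transitivity (\esum_(i in [set i | f i != 0%R]) (f i)%:E)%E.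
  rewrite [RHS]esum_mkcond; apply: eq_esum => i _.
  by case: ifPn => //; rewrite notin_setE/= => /negP; rewrite negbK => /eqP ->.
by rewrite -fsumEFin// -esum_fset// => i _; rewrite lee_fin.
Qed.

(** Replacing values by their rank turns the potential below into an integer,
    which can only decrease finitely often. *)
Definition rank (s : seq R) (t : R) : nat := count (fun v => v < t) s.

Lemma rank_le s t t' : t <= t' -> (rank s t <= rank s t')%N.
Proof. by move=> tt; apply: sub_count => v /= /lt_le_trans; exact. Qed.

Lemma rank_lt s t t' : t \in s -> t < t' -> (rank s t < rank s t')%N.
Proof.
move=> ts tt; elim: s ts => // v s IH; rewrite inE => /orP[/eqP <-|/IH h] /=.
  by rewrite ltxx tt add0n add1n ltnS; exact: rank_le (ltW tt).
rewrite -addnS leq_add//.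
by case: (ltP v t) => // vt; rewrite (lt_trans vt tt).
Qed.

Lemma rank0 s : (forall v, v \in s -> 0 <= v) -> rank s 0 = 0%N.
Proof.
move=> s0; apply/eqP; rewrite -leqn0 leqNgt -has_count; apply/hasPn => v /s0.
by rewrite leNgt.
Qed.

Arguments rank : simpl never.

Definition potential s w : \bar R :=
  \esum_(x in [set: lattice N]) ((psi x)%:~R * (rank s (w x))%:R)%:E.

Lemma pot_term_ge0 s w x : 0 <= (psi x)%:~R * (rank s (w x))%:R :> R.
Proof. by rewrite mulr_ge0// ler0z psi_ge0. Qed.

Lemma refl_shift a m x : refl a m x = x + (m - (if dot a a == 1 then 2 else 1) * dot a x) *: a.
Proof. by []. Qed.

(** A polarization that changes [w] at [x0] moves a larger rank to a point where
    [psi] is smaller, and gains at least one unit there. *)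
Lemma potential_polarize s w a m x0 : axis a ->
  (forall x, w x \in s) ->
  key (dot a x0) < key (dot a (refl a m x0)) -> w x0 < w (refl a m x0) ->
  (potential s (polarize a m w) + 1 <= potential s w)%E.
Proof.
move=> ra ws kx wx.
pose F v x : R := (psi x)%:~R * (rank s (v x))%:R.
pose f x := F (polarize a m w) x + (x == x0)%:R.
have x0s : x0 != refl a m x0 by apply: contraTneq kx => <-; rewrite ltxx.
have st x : key (dot a x) <= key (dot a (refl a m x)) ->
    f x + f (refl a m x) <= F w x + F w (refl a m x).
  move=> h; rewrite /f /F !(polarize_good w ra h).
  have sx0 : (refl a m x == x0) = false.
    apply/negbTE/negP => /eqP e; move: kx; rewrite -e reflK// => k.
    by move: h; rewrite leNgt k.
  rewrite sx0 addr0.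
  have A0 := psi_ge0 x.
  have [ex|nx] := eqVneq x x0.
    rewrite ex maxC !(max_l (ltW wx)) (min_l (ltW wx)).
    have AB := psi_lt ra kx; rewrite -refl_shift in AB.
    have := rank_lt (ws x0) wx.
    rewrite ex in A0; move: (psi x0) (psi (refl a m x0)) (rank s (w x0)) (rank s (w (refl a m x0))) A0 AB.
    move=> A B i j A0 AB.
    move=> ij; have h1 : 0 < (B - A) * (j%:Z - i%:Z) by apply: mulr_gt0; lia.
    have : A * j%:Z + 1 + B * i%:Z <= A * i%:Z + B * j%:Z by lia.
    by rewrite -(ler_int R) !rmorphD/= !rmorphM.
  have AB : psi x <= psi (refl a m x).
    move: h; rewrite le_eqVlt => /orP[/eqP/key_refl_eq->//|/(psi_lt ra)].
    by rewrite -refl_shift => /ltW.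
  case: (leP (w x)) => /= ww; last by rewrite addr0.
  have := rank_le s ww.
  move: (psi x) (psi (refl a m x)) (rank s (w x)) (rank s (w (refl a m x))) A0 AB.
  move=> A B i j A0 AB; rewrite addr0.
  move=> ij; have h1 : 0 <= (B - A) * (j%:Z - i%:Z) by apply: mulr_ge0; lia.
  have : A * j%:Z + B * i%:Z <= A * i%:Z + B * j%:Z by lia.
  by rewrite -(ler_int R) !rmorphD/= !rmorphM.
have f0 x : 0 <= f x by rewrite addr_ge0// pot_term_ge0.
have : (\esum_(x in [set: lattice N]) (f x)%:E <= potential s w)%E.
  apply: (le_esum_inv (reflK m ra)) => [//|x|x]; first exact: pot_term_ge0.
  have [h|h] := leP (key (dot a x)) (key (dot a (refl a m x))); first exact: st.
  rewrite addrC [leRHS]addrC.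
  by have := st (refl a m x); rewrite reflK// => st'; apply: st'; exact: ltW.
apply: le_trans.
rewrite (eq_esum (b := fun x => ((F (polarize a m w) x)%:E + ((x == x0)%:R)%:E)%E))//.
rewrite esumD; [|by move=> x _; rewrite lee_fin// pot_term_ge0..].
rewrite leeD2l//.
have : (\esum_(x in [set x0]) 1%:E <= \esum_(x in [set: lattice N]) ((x == x0)%:R)%:E :> \bar R)%E.
  rewrite esum_mkcond; apply: le_esum => x _.
  by case: ifPn => [/set_mem ->|_]; rewrite ?eqxx// lee_fin.
by rewrite esum_set1.
Qed.

Lemma polarize_ge0 a m w : (forall x, 0 <= w x) -> forall x, 0 <= polarize a m w x.
Proof. by move=> w0 x; rewrite /polarize; case: ifP; rewrite ?le_max ?le_min !w0. Qed.

Lemma polarize_val a m w x : polarize a m w x = w x \/ polarize a m w x = w (refl a m x).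
Proof. by rewrite /polarize; case: ifP => _; case: leP => _; [right|left|left|right]. Qed.

Lemma polarize_fsupp a m w : axis a -> finitely_supported w ->
  finitely_supported (polarize a m w).
Proof.
move=> ra fw; apply: (@sub_finite_set _ _ ([set x | w x != 0] `|` (refl a m @` [set x | w x != 0]))).
  move=> x /=; have [->|->] := polarize_val a m w x; first by left.
  by right; exists (refl a m x) => //; rewrite reflK.
by rewrite finite_setU; split => //; exact: finite_image.
Qed.

(** Polarize as long as [w] is not aligned. This terminates since the potential
    drops by at least 1 each time, and it replaces the rearrangement inequalities
    for the full Schwarz symmetrization. *)
Theorem symmetrize p b q w : 1 <= p -> b <= 0 -> 0 <= q ->
  (forall x, 0 <= w x) -> finitely_supported w ->
  exists w', [/\ forall x, 0 <= w' x, finitely_supported w', aligned w',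
    (energy p w' <= energy p w)%E & (mass b q w <= mass b q w')%E].
Proof.
move=> p1 b0 q0 w0 fw.
pose s : seq R := 0 :: [seq w x | x <- fset_set [set x | w x != 0]].
have s0 v : v \in s -> 0 <= v.
  by rewrite inE => /orP[/eqP->//|/mapP[x _ ->]].
have ws x : w x \in s.
  rewrite inE; have [//|nx] := eqVneq (w x) 0.
  by apply/orP; right; apply/mapP; exists x => //; rewrite in_fset_set// inE.
have [n pn] : exists n : nat, (potential s w <= n%:R%:E)%E.
  rewrite /potential esum_fsupp.
  - move: (\sum_(_ \in _) _) => M; exists (Num.truncn M).+1.
    by rewrite lee_fin; apply/ltW/truncnS_gt.
  - by move=> x; exact: pot_term_ge0.
  - apply: sub_finite_set fw => x /=; apply: contraNneq => ->.
    by rewrite rank0// mulr0.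
clearbody s; elim: n w w0 fw ws pn => [|n IH] w w0 fw ws pn;
  (have [al|/existsNP[a /existsNP[x /existsNP[c /not_implyP[ra /not_implyP[kx /negP]]]]]] :=
    pselect (aligned w); first by exists w).
all: rewrite -ltNge => wx.
all: pose m := c + (if dot a a == 1 then 2 else 1) * dot a x.
all: have ex : x + c *: a = refl a m x by rewrite /refl /m addrK.
all: rewrite ex in kx wx.
all: have h := potential_polarize ra ws kx wx.
  have : (0 <= potential s (polarize a m w))%E.
    by apply: esum_ge0 => y _; rewrite lee_fin pot_term_ge0.
  move=> h0; have := le_trans (leeD2r 1 h0) (le_trans h pn).
  by rewrite add0e lee_fin ler10.
have [||||w' [w'0 fw' aw' ew' mw']] := IH (polarize a m w).
- exact: polarize_ge0.
- exact: polarize_fsupp.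
- by move=> y; have [->|->] := polarize_val a m w y.
- have := le_trans h pn; rewrite -natr1 EFinD.
  by rewrite leeD2rE.
exists w'; split; [exact: w'0|exact: fw'|exact: aw'| |].
- exact: le_trans ew' (energy_polarize _ _ p1 ra).
- exact: le_trans (mass_polarize _ b0 q0 ra w0) mw'.
Qed.

End Symmetrization.

(** * Pointwise decay of aligned functions *)

Section Domination.
Variables (R : realType) (N : nat) (u : lattice N -> R).
Hypothesis au : aligned u.
Implicit Types (x y z a : lattice N) (i j : 'I_N) (k t : int).

Definition upd x i t : lattice N := x + (t - x 0 i) *: delta_mx 0 i.

Lemma updE x i t j : upd x i t 0 j = if j == i then t else x 0 j.
Proof.
rewrite !mxE eqxx/=; case: eqVneq => [->|_]; first by rewrite mulr1 subrKC.
by rewrite mulr0 addr0.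
Qed.

Lemma aligned_axis a x y c : axis a -> x = y + c *: a ->
  key (dot a y) < key (dot a x) -> u x <= u y.
Proof. by move=> ra -> h; exact: au. Qed.

Lemma aligned_upd x i t : key t < key (x 0 i) -> u x <= u (upd x i t).
Proof.
move=> h; apply: (@aligned_axis (delta_mx 0 i) _ _ (x 0 i - t)).
- by constructor 1; exists i.
- by rewrite /upd -addrA -scalerDl addrC subrKA subrr scale0r add0r.
- by rewrite !dot_deltal updE eqxx.
Qed.

Lemma aligned_upd_lt x i t : `|t| < `|x 0 i| -> u x <= u (upd x i t).
Proof. by move=> h; apply: aligned_upd; move: h; rewrite /key; lia. Qed.

Lemma aligned_transfer x i j k : i != j -> x 0 j = 0 -> 0 < k -> 2 * k < x 0 i ->
  u x <= u (x + k *: (delta_mx 0 j - delta_mx 0 i)).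
Proof.
move=> ij xj k0 kx.
have [lt_ij|lt_ji|/val_inj e] := ltngtP i j; last by rewrite e eqxx in ij.
- apply: (@aligned_axis (delta_mx 0 i - delta_mx 0 j) _ _ k).
  + by constructor 2; exists i, j.
  + by rewrite -addrA -scalerDr addrA subrK subrr scaler0 addr0.
  + rewrite !dotE !dot_deltal !mxE !eqxx !(ltn_ord_neq lt_ij) xj /key /=.
    by move: (x 0 i) kx => s; lia.
- apply: (@aligned_axis (delta_mx 0 j - delta_mx 0 i) _ _ (- k)).
  + by constructor 2; exists j, i.
  + by rewrite scaleNr addrK.
  + rewrite !dotE !dot_deltal !mxE !eqxx !(ltn_ord_neq lt_ji) xj /key /=.
    by move: (x 0 i) kx => s; lia.
Qed.

Lemma transferE x i j k (l : 'I_N) :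
  (x + k *: (delta_mx 0 j - delta_mx 0 i)) 0 l = x 0 l + k * ((l == j)%:R - (l == i)%:R).
Proof. by rewrite !mxE eqxx. Qed.

(** Along a difference of two coordinate axes an aligned function does not
    decrease when an amount [k] is moved from a large coordinate to a vanishing
    one. Distributing [k] in turn to the coordinates of [s] makes room for any
    values smaller than [k] there. *)
Lemma aligned_spread k i (s : seq 'I_N) x y : 0 < k -> i \notin s ->
  ((size s).+2)%:Z * k <= x 0 i -> `|y 0 i| < k -> (forall j, j \in s -> `|y 0 j| < k) ->
  (forall j, j \notin s -> j != i -> y 0 j = x 0 j) -> u x <= u y.
Proof.
move=> k0; elim: s x => [|j s IH] x is_ xi yi ys yx.
  have -> : y = upd x i (y 0 i).
    by apply/rowP => j; rewrite updE; case: eqVneq => [->//|ji]; rewrite yx.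
  by apply: aligned_upd_lt; move: (y 0 i) (x 0 i) xi yi => /= s t; lia.
move: is_; rewrite inE negb_or => /andP[ij is_].
pose x1 := upd x j 0.
have xx1 : u x <= u x1.
  have [e|xj0] := eqVneq (x 0 j) 0.
    rewrite (_ : x1 = x)//; apply/rowP => l; rewrite updE.
    by case: eqVneq => [->|].
  by apply: aligned_upd_lt; rewrite normr0 normr_gt0.
have x1i : x1 0 i = x 0 i by rewrite updE (negbTE ij).
have x1j : x1 0 j = 0 by rewrite updE eqxx.
pose x2 := x1 + k *: (delta_mx 0 j - delta_mx 0 i).
have xx2 : u x1 <= u x2.
  apply: aligned_transfer => //; rewrite x1i; move: xi => /=.
  by move: (x 0 i) (size s) => t n; nia.
have x2j : x2 0 j = k by rewrite transferE x1j eqxx (eq_sym j) (negbTE ij) /= subr0 mulr1 add0r.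
pose x3 := upd x2 j (y 0 j).
have xx3 : u x2 <= u x3.
  apply: aligned_upd_lt; rewrite x2j (gtr0_norm k0); apply: ys.
  by rewrite inE eqxx.
apply: (le_trans xx1); apply: (le_trans xx2); apply: (le_trans xx3).
apply: IH => //.
- rewrite updE (negbTE ij) transferE x1i eqxx (negbTE ij) /= sub0r mulrN1.
  by move: xi => /=; move: (x 0 i) (size s) => t n; nia.
- by move=> l ls; apply: ys; rewrite inE ls orbT.
- move=> l ls li; rewrite updE; case: eqVneq => [->//|lj].
  rewrite transferE updE (negbTE lj) (negbTE li) /= subr0 mulr0 addr0.
  by apply: yx => //; rewrite inE negb_or lj.
Qed.

(** A reflection makes the large coordinate positive; it can then give [k] to each of
    the other [N - 1] coordinates and still be at least [2 k]. *)
Lemma aligned_dominated k i x y : 0 < k -> (N.+1)%:Z * k <= `|x 0 i| ->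
  (forall j, `|y 0 j| < k) -> u x <= u y.
Proof.
move=> k0 xi ys.
pose x' := upd x i `|x 0 i|.
have xx : u x <= u x'.
  have [h|h] := leP 0 (x 0 i).
    rewrite (_ : x' = x)//; apply/rowP => l; rewrite updE.
    by case: eqVneq => [->|//]; rewrite ger0_norm.
  by apply: aligned_upd; rewrite /key; lia.
apply: (le_trans xx).
apply: (@aligned_spread k i (rem i (enum 'I_N))) => //.
- by rewrite mem_rem_uniq ?enum_uniq// inE eqxx.
- rewrite updE eqxx size_rem ?mem_enum// size_enum_ord.
  by rewrite (_ : N.-1.+2 = N.+1)//; have := ltn_ord i; lia.
- by move=> j; rewrite mem_rem_uniq ?enum_uniq// inE/= mem_enum andbT => /negP h /h.
Qed.

End Domination.

Section Decay.
Variables (R : realType) (N : nat) (p : R) (i0 : 'I_N).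
Hypotheses (p1 : 1 < p) (pN : p < N%:R).
Implicit Types (x y z : lattice N) (u : lattice N -> R).

Local Notation e0 := (delta_mx 0 i0 : lattice N).

Definition decay_exponent : R := N%:R / p - 1.
Local Notation alpha := decay_exponent.

Let p_gt0 : 0 < p := lt_trans ltr01 p1.

Lemma decay_exponent_gt0 : 0 < alpha.
Proof. by rewrite /decay_exponent subr_gt0 ltr_pdivlMr ?mul1r// (lt_trans ltr01). Qed.

Lemma neighbor_e0 x : neighbor x (x + e0).
Proof. by rewrite neighborE addrC addKr dot_deltal mxE !eqxx. Qed.

Lemma edge_dens u x : `|u (x + e0) - u x| `^ p <= dens p u x.
Proof.
rewrite densE (big_rem (x + e0)) ?mem_nbhd ?neighbor_e0//= lerDl.
by apply: sumr_ge0 => y _; exact: powR_ge0.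
Qed.

Lemma energy_sum_le u (E : R) (I : finType) (h : I -> lattice N) :
  (energy p u <= E%:E)%E -> injective h -> \sum_i dens p u (h i) <= E.
Proof.
move=> uE hi.
have /(esum_leP E) [/(_ uE) H _] : forall x, 0 <= dens p u x by move=> x; exact: dens_ge0.
have := H [fset h i | i in I]%fset; rewrite big_imfset//=; last by move=> a b _ _; exact: hi.
by rewrite big_enum.
Qed.

(** Summed over a finite set with a suitable [l], this does the work of the
    Holder inequality. *)
Lemma young_split (l a : R) : 0 < l -> 0 <= a -> a <= l + l `^ (1 - p) * a `^ p.
Proof.
move=> l0 a0; have [al|la] := leP a l.
  by apply: (le_trans al); rewrite lerDl mulr_ge0 ?powR_ge0.
have a0' : 0 < a by apply: lt_trans la.
apply: (@le_trans _ _ (l `^ (1 - p) * a `^ p)); last by rewrite lerDr ltW.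
rewrite -{1}(mulr1 a) -(@mulr_powRB1 _ a p)//.
rewrite mulrCA ler_pM2l// -(opprB p 1) powRN mulrC ler_pdivlMr ?powR_gt0// mul1r.
by apply: ge0_ler_powR; rewrite ?nnegrE ?subr_ge0 ?ltW.
Qed.

Let g u (n : nat) : R := u ((N.+1 * n)%:Z *: e0).
Let L : nat := (N.+1 * (2 * N + 3))%N.

Lemma e0E (c : int) j : (c *: e0) 0 j = if j == i0 then c else 0.
Proof. by rewrite !mxE eqxx/=; case: ifP; rewrite ?mulr1 ?mulr0. Qed.

Lemma e0_lt (m : nat) j : `|(m%:Z *: e0) 0 j| < m.+1%:Z.
Proof. by rewrite e0E; case: ifP; lia. Qed.

Let PoszS (m : nat) : m.+1%:Z = m%:Z + 1.
Proof. by lia. Qed.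

(** Translate the cube {0, ..., n - 1}^N by [L n] along a coordinate axis, far
    enough for the values there to be at most the value at distance 2 (N + 1) n.
    On average over the cube the function drops by at least [g n - g (2 n)]; this is
    a sum of [L n] edge differences, the average p-th power of each being at most
    E / n^N. *)
Lemma decay_step u (E : R) (n : nat) : aligned u -> 0 < E -> (0 < n)%N ->
  (energy p u <= E%:E)%E ->
  g u n <= g u (2 * n)%N + 2 * L%:R * E `^ p^-1 * n%:R `^ (- alpha).
Proof.
move=> au E0 n0 uE.
have n0R : 0 < n%:R :> R by rewrite ltr0n.
(* the l for which the two terms of [young_split] balance on average *)
pose l : R := E `^ p^-1 * n%:R `^ (- (N%:R / p)).
have l0 : 0 < l by rewrite mulr_gt0 ?powR_gt0.
pose F := {ffun 'I_N -> 'I_n}.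
pose D (f : F) (k : nat) : R := `|u (boxfun f + k%:Z *: e0 + e0) - u (boxfun f + k%:Z *: e0)|.
have step f : g u n - g u (2 * n)%N <= \sum_(k < L * n) D f k.
  have h1 : g u n <= u (boxfun f).
    apply: (@aligned_dominated _ _ _ au n i0); first by lia.
      by rewrite e0E eqxx; lia.
    by move=> j; rewrite mxE; have := ltn_ord (f j); lia.
  have h2 : u (boxfun f + (L * n)%:Z *: e0) <= g u (2 * n)%N.
    apply: (@aligned_dominated _ _ _ au (N.+1 * (2 * n)).+1 i0); first by lia.
      rewrite mxE e0E eqxx mxE; have := ltn_ord (f i0); rewrite /L; nia.
    exact: e0_lt.
  have tel m : u (boxfun f) - u (boxfun f + m%:Z *: e0) <= \sum_(k < m) D f k.
    elim: m => [|m IH]; first by rewrite scale0r addr0 subrr big_ord0.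
    rewrite big_ord_recr/= -[leLHS](subrKA (u (boxfun f + m%:Z *: e0))) lerD//.
    rewrite PoszS /D distrC scalerDl scale1r addrA.
    exact: ler_norm.
  by have := tel (L * n)%N; lra.
have sumE k : \sum_(f : F) D f k `^ p <= E.
  apply: le_trans (energy_sum_le (h := fun f : F => boxfun f + k%:Z *: e0) uE _).
    by apply: ler_sum => f _; exact: edge_dens.
  by move=> f f' /addIr/boxfun_inj.
have tot : #|F|%:R * (g u n - g u (2 * n)%N) <=
    (L * n)%:R * (#|F|%:R * l + l `^ (1 - p) * E).
  apply: (@le_trans _ _ (\sum_(f : F) \sum_(k < L * n) D f k)).
    by rewrite mulr_natl -sumr_const; apply: ler_sum => f _; exact: step.
  rewrite exchange_big/= mulr_natl.
  rewrite -[X in _ *+ X]card_ord -sumr_const; apply: ler_sum => k _.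
  apply: (@le_trans _ _ (\sum_(f : F) (l + l `^ (1 - p) * D f k `^ p))).
    by apply: ler_sum => f _; apply: young_split => //; exact: normr_ge0.
  rewrite big_split/= sumr_const mulr_natl lerD2l -mulr_sumr ler_wpM2l ?powR_ge0//.
have cF : #|F|%:R = n%:R `^ N%:R :> R.
  by rewrite card_ffun !card_ord natrX powR_mulrn.
have lp : l `^ p = E / n%:R `^ N%:R.
  rewrite /l powRM ?powR_ge0// -!powRrM mulVf ?gt_eqF// powRr1 ?(ltW E0)//.
  by rewrite mulNr divfK ?gt_eqF// powRN.
have lE : l `^ (1 - p) * E = n%:R `^ N%:R * l.
  rewrite powRB; last by rewrite (gt_eqF l0) implybT.
  rewrite powRr1 ?(ltW l0)// lp.
  by field; rewrite !gt_eqF ?powR_gt0.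
rewrite cF lE -mulrDr -mulr2n mulrCA ler_pM2l ?powR_gt0// in tot.
rewrite -lerBlDl; apply: (le_trans tot).
have nl : n%:R * n%:R `^ (- (N%:R / p)) = n%:R `^ (- alpha) :> R.
  by rewrite /decay_exponent opprB powRD ?(gt_eqF n0R) ?implybT// powRr1 ?(ltW n0R).
rewrite -nl /l -mulr_natr natrM; lra.
Qed.

Let rho : R := 2 `^ (- alpha).

Lemma rho_lt1 : rho < 1.
Proof.
rewrite /rho powRN invf_lt1 ?powR_gt0//.
have := gt0_ltr_powR decay_exponent_gt0 (ler01 : 1 \in Num.nneg) (ler0n R 2 : 2 \in Num.nneg).
by rewrite powR1; apply; rewrite ltrDl.
Qed.

(** The increments of [decay_step] along the scales n, 2 n, 4 n, and so on are
    geometric of ratio [rho]; the sum stops because the support is finite. *)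
Lemma decay_axis u (E : R) (n : nat) : aligned u -> finitely_supported u -> 0 < E ->
  (0 < n)%N -> (energy p u <= E%:E)%E ->
  g u n <= 2 * L%:R / (1 - rho) * E `^ p^-1 * n%:R `^ (- alpha).
Proof.
move=> au fu E0 n0 uE; have r1 := rho_lt1.
have [M gM] : exists M : nat, forall n, (M <= n)%N -> g u n = 0.
  pose A := fset_set [set x | u x != 0].
  exists (\max_(x <- A) `|(x 0 i0)%R|%N).+1 => k Mk; apply/eqP; apply: contraLR Mk => gk.
  rewrite -leqNgt; apply: (@leq_trans (N.+1 * k)%N); first by rewrite leq_pmull.
  have kA : ((N.+1 * k)%:Z *: e0) \in A by rewrite in_fset_set// inE.
  have := @leq_bigmax_seq _ (enum_fset A) xpredT (fun x : lattice N => `|(x 0 i0)%R|%N) _ kA isT.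
  by rewrite e0E eqxx.
have [k Mk] : exists k, (M <= n * 2 ^ k)%N.
  by exists M; rewrite (leq_trans (ltnW (ltn_expl M (ltnSn 1))))// leq_pmull.
elim: k n n0 Mk => [|k IH] n n0 Mk.
  rewrite gM; last by rewrite muln1 in Mk.
  by rewrite !mulr_ge0 ?powR_ge0 ?invr_ge0// subr_ge0 ltW.
have n0R : 0 < n%:R :> R by rewrite ltr0n.
apply: (le_trans (decay_step au E0 n0 uE)).
have := IH (2 * n)%N; rewrite muln_gt0 n0 => /(_ isT).
rewrite (mulnC 2) -mulnA -expnS => /(_ Mk) h.
apply: (le_trans (lerD h (lexx _))).
rewrite natrM powRM ?ler0n// -/rho.
rewrite le_eqVlt; apply/orP; left; apply/eqP.
field; rewrite gt_eqF//; lra.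
Qed.

Let near_origin (d : nat) (t : int) : (0 < N)%N -> (d < N * N.+1 * N.+2)%N ->
  `|t| <= d%:Z ->
  (N.+1 * (N.+1 * 1).+1)%:Z <= `|t + (2 * (N * N.+1 * N.+2))%:Z|.
Proof. by move=> *; nia. Qed.

Let box_radius (n : nat) : (0 < N)%N -> (0 < n)%N ->
  (N * (N.+1 * (N.+1 * n).+1).-1 < n * (N * N.+1 * N.+2))%N.
Proof. by move=> *; nia. Qed.

Let le_pred_int (m : nat) (t : int) : ~ (m.+1%:Z <= t) -> t <= m%:Z.
Proof. by lia. Qed.

Let double_lt (d A : nat) : (d < A -> d.+1 < 2 * A)%N.
Proof. by lia. Qed.

Let quotient_bound (d A n : nat) : (0 < n -> d < n.+1 * A -> d.+1 <= 2 * A * n)%N.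
Proof. by nia. Qed.

(** The discrete form of the radial lemma: the energy alone controls an aligned
    function by the profile d(x)^(1 - N/p). Far from the origin this is
    [decay_axis]; a point near the origin is joined to a far one by a segment of
    bounded length, each edge of which costs at most [E `^ p^-1]. *)
Lemma decay_pointwise : exists2 C : R, 0 < C &
  forall u (E : R), aligned u -> finitely_supported u -> 0 < E ->
  (energy p u <= E%:E)%E ->
  forall x, u x <= C * E `^ p^-1 * (1 + (graph_dist x 0)%:R) `^ (- alpha).
Proof.
have r1 := rho_lt1; have a0 := decay_exponent_gt0.
have N0 : (0 < N)%N by have := ltn_ord i0; lia.
pose A := (N * N.+1 * N.+2)%N.
have A0 : (0 < A)%N by rewrite /A; lia.
pose C0 : R := 2 * L%:R / (1 - rho).
have C00 : 0 <= C0 by rewrite /C0 divr_ge0 ?mulr_ge0 ?subr_ge0 ?(ltW r1).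
have C2 : 0 <= C0 + 2 * A%:R by apply: addr_ge0 => //; rewrite mulr_ge0.
exists ((C0 + 2 * A%:R) * (2 * A%:R) `^ alpha).
  by rewrite mulr_gt0 ?powR_gt0 ?ltr_wpDl ?mulr_gt0 ?ltr0n.
move=> u E au fu E0 uE.
have EG : 0 < E `^ p^-1 by rewrite powR_gt0.
have far n x i : (0 < n)%N -> (N.+1 * (N.+1 * n).+1)%:Z <= `|x 0 i| ->
    u x <= C0 * E `^ p^-1 * n%:R `^ (- alpha).
  move=> n0 xi; apply: (@le_trans _ _ (g u n)); last exact: decay_axis.
  apply: (@aligned_dominated _ _ _ au (N.+1 * n).+1 i) => //.
  exact: e0_lt.
move=> x; set d := graph_dist x 0.
have d1 : 0 < 1 + d%:R :> R by rewrite ltr_pwDl.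
have [dA|Ad] := ltnP d A.
  have hor m : u x - u (x + m%:Z *: e0) <= m%:R * E `^ p^-1.
    elim: m => [|m IH]; first by rewrite scale0r addr0 subrr mul0r.
    rewrite PoszS scalerDl scale1r addrA -[leLHS](subrKA (u (x + m%:Z *: e0))).
    rewrite -natr1 mulrDl mul1r lerD//.
    apply: (le_trans (ler_norm _)); rewrite distrC.
    set y := x + _; have : `|u (y + e0) - u y| `^ p <= E.
      apply: (le_trans (edge_dens u y)).
      have /(esum_leP E) [/(_ uE) /(_ [fset y]%fset) + _] : forall x, 0 <= dens p u x by move=> z; exact: dens_ge0.
      by rewrite big_seq_fset1.
    move=> h; rewrite -[leLHS](@powRr1 _ _ (normr_ge0 _)) -(mulfV (x := p)) ?gt_eqF//.
    rewrite powRrM; apply: ge0_ler_powR; rewrite ?nnegrE ?powR_ge0 ?invr_ge0 ?(ltW E0) ?(ltW p_gt0)//.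
  have h1 := hor (2 * A)%N.
  have h2 : u (x + (2 * A)%:Z *: e0) <= C0 * E `^ p^-1.
    have := @far 1%N (x + (2 * A)%:Z *: e0) i0 isT; rewrite powR1 mulr1; apply.
    rewrite mxE e0E eqxx; have := l1_ge x i0; rewrite -graph_dist_l1 -/d.
    exact: near_origin.
  apply: (@le_trans _ _ ((C0 + 2 * A%:R) * E `^ p^-1)).
    by move: h1; rewrite natrM; lra.
  rewrite [leRHS](_ : _ = (C0 + 2 * A%:R) * E `^ p^-1 * ((2 * A%:R) `^ alpha * (1 + d%:R) `^ (- alpha))); last by ring.
  apply: ler_peMr; first by apply: mulr_ge0; [exact: C2|exact: ltW].
  rewrite powRN ler_pdivlMr ?powR_gt0// mul1r.
  apply: ge0_ler_powR; rewrite ?nnegrE ?ltW// ?mulr_gt0 ?ltr0n//.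
  by rewrite -natrM nat1r ltr_nat double_lt.
pose n := (d %/ A)%N.
have n0 : (0 < n)%N by rewrite divn_gt0.
have [i xi] : exists i, (N.+1 * (N.+1 * n).+1)%:Z <= `|x 0 i|.
  apply/not_existsP => h.
  have : l1 x <= (N * (N.+1 * (N.+1 * n).+1).-1)%:Z.
    by apply: ge_l1 => i; apply: le_pred_int; exact: h.
  rewrite -graph_dist_l1 -/d lez_nat => hd.
  have := leq_trans (leq_trunc_div d A) hd.
  by rewrite leqNgt box_radius.
apply: (le_trans (far n x i n0 xi)).
have n0R : 0 < n%:R :> R by rewrite ltr0n.
have : n%:R `^ (- alpha) <= (2 * A%:R) `^ alpha * (1 + d%:R) `^ (- alpha).
  rewrite !powRN ler_pdivlMr ?powR_gt0// mulrC ler_pdivrMr ?powR_gt0//.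
  rewrite -powRM ?ler0n ?mulr_ge0//.
  have le1 : 1 + d%:R <= 2 * A%:R * n%:R :> R.
    rewrite -!natrM nat1r ler_nat.
    exact: quotient_bound (ltn_ceil d A0).
  by apply: ge0_ler_powR => //; rewrite ?nnegrE ?mulr_ge0 ?ler0n// ltW.
move=> h; apply: (@le_trans _ _ (C0 * E `^ p^-1 * ((2 * A%:R) `^ alpha * (1 + d%:R) `^ (- alpha)))).
  by rewrite ler_wpM2l// mulr_ge0// ltW.
rewrite [leRHS](_ : _ = (C0 + 2 * A%:R) * E `^ p^-1 * ((2 * A%:R) `^ alpha * (1 + d%:R) `^ (- alpha))); last by ring.
by rewrite ler_wpM2r ?mulr_ge0 ?powR_ge0// ler_wpM2r ?lerDl ?mulr_ge0// ltW.
Qed.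

End Decay.

(** * Summability of the decay profile and powers of the absolute value *)

Section Summability.
Variables (R : realType) (N : nat).
Implicit Types (x : lattice N) (X : {fset lattice N}).

(** The ball lies in the cube of side [2 m]. *)
Lemma count_ball X (m : nat) :
  (count (fun x => graph_dist x 0 < m)%N X <= (2 * m) ^ N)%N.
Proof.
pose sh : lattice N := \row_i m%:Z.
rewrite -size_filter.
have -> : ((2 * m) ^ N)%N = size [seq boxfun f - sh | f : {ffun 'I_N -> 'I_(2 * m)}].
  by rewrite size_map -cardE card_ffun !card_ord.
apply: uniq_leq_size; first exact/filter_uniq/fset_uniq.
move=> x; rewrite mem_filter => /andP[xm _].
have P (i : 'I_N) : (`|(x 0 i + m%:Z)%R| < 2 * m)%N.
  by have := l1_ge x i; rewrite -graph_dist_l1; move: (x 0 i) => k; lia.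
apply/mapP; exists [ffun i => Ordinal (P i)]; first by rewrite mem_enum.
apply/rowP => i; rewrite !mxE ffunE/=.
by have := l1_ge x i; rewrite -graph_dist_l1; move: (x 0 i) => k; lia.
Qed.

Let powRN_exprn (a r : R) (n : nat) : 0 <= a ->
  ((a ^+ n) `^ r)^-1 = (a `^ (- r)) ^+ n.
Proof.
move=> a0; rewrite powRN exprVn; congr (_^-1).
by rewrite -(powR_mulrn n a0) -(powR_mulrn n (powR_ge0 a r)) powRAC.
Qed.

(** The dyadic annulus of radius 2^J contributes at most (4 * 2^J)^N 2^(- beta J),
    which is geometric in J. *)
Lemma summable_dist (beta : R) : N%:R < beta ->
  exists M : R, forall X, \sum_(x <- X) (1 + (graph_dist x 0)%:R) `^ (- beta) <= M.
Proof.
move=> Nb; pose h x : R := (1 + (graph_dist x 0)%:R) `^ (- beta).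
have h0 x : 0 <= h x by exact: powR_ge0.
pose rho : R := 2 `^ (N%:R - beta).
have rho0 : 0 < rho by rewrite powR_gt0.
have rho1 : rho < 1.
  rewrite /rho -opprB powRN invf_lt1 ?powR_gt0//.
  have := @gt0_ltr_powR R (beta - N%:R) _ 1 2; rewrite powR1.
  by apply; rewrite ?subr_gt0 ?nnegrE ?ltrDl.
pose S X J := \sum_(x <- X | (graph_dist x 0 < 2 ^ J)%N) h x.
have annulus X (m k : nat) (c : R) : 0 <= c ->
    (forall x, (k <= graph_dist x 0 < m)%N -> h x <= c) ->
    \sum_(x <- X | (k <= graph_dist x 0 < m)%N) h x <= ((2 * m) ^ N)%:R * c.
  move=> c0 hc; apply: (@le_trans _ _ (\sum_(x <- X | (graph_dist x 0 < m)%N) c)).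
    rewrite [leRHS](bigID (fun x => k <= graph_dist x 0)%N)/=.
    apply: ler_wpDr; first by apply: sumr_ge0.
    under [leRHS]eq_bigl do rewrite andbC.
    exact: ler_sum.
  rewrite big_const_seq iter_addr_0 -[leLHS]mulr_natl ler_wpM2r// ler_nat.
  exact: count_ball.
have S0 X : S X 0%N <= (4 ^ N)%:R.
  have := annulus X 1%N 0%N 1 ler01.
  rewrite mulr1 => /(_ _) H; apply: (le_trans (H _)).
    move=> x _; rewrite /h powRN invf_le1 ?powR_gt0 ?ltr_pwDl//.
    have := @ge0_ler_powR R beta _ 1 (1 + (graph_dist x 0)%:R); rewrite powR1.
    apply; rewrite ?nnegrE ?addr_ge0// ?lerDl//.
    by apply: le_trans (ltW Nb).
  by rewrite ler_nat; case: (N) => [|n]; rewrite ?expn0 ?leq_exp2r.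
have SS X J : S X J.+1 <= S X J + (4 ^ N)%:R * rho ^+ J.
  rewrite /S (bigID (fun x => (graph_dist x 0 < 2 ^ J)%N))/= lerD//.
    rewrite le_eqVlt; apply/orP; left; apply/eqP; apply: eq_bigl => x.
    rewrite andb_idl// => /ltn_trans; apply.
    by rewrite ltn_exp2l.
  under eq_bigl do rewrite -leqNgt andbC.
  apply: (le_trans (annulus X _ _ ((2 ^ J)%:R `^ (- beta)) (powR_ge0 _ _) _)).
    move=> x /andP[kx _]; rewrite /h !powRN lef_pV2 ?posrE ?powR_gt0 ?ltr_pwDl ?ltr0n ?expn_gt0//.
    apply: ge0_ler_powR; rewrite ?nnegrE ?addr_ge0//.
      by apply: le_trans (ltW Nb).
    by rewrite nat1r ler_nat leqW.
  rewrite expnS mulnA expnMn natrM -mulrA ler_wpM2l ?ler0n//.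
  rewrite /rho powRD ?pnatr_eq0 ?implybT// exprMn powR_mulrn// powRN.
  rewrite le_eqVlt; apply/orP; left; apply/eqP.
  rewrite -expnM mulnC expnM !natrX; congr (_ * _).
  by rewrite powRN_exprn.
have SJ X J : S X J <= (4 ^ N)%:R * (1 + (1 - rho ^+ J) / (1 - rho)).
  elim: J => [|J IH]; first by rewrite expr0 subrr mul0r addr0 mulr1.
  apply: (le_trans (SS X J)); apply: (le_trans (lerD IH (lexx _))).
  rewrite -mulrDr le_eqVlt; apply/orP; left; apply/eqP; congr (_ * _).
  rewrite exprS; field; lra.
exists ((4 ^ N)%:R * (1 + 1 / (1 - rho))) => X.
pose J := (\max_(x <- enum_fset X) graph_dist x 0)%N.
apply: (@le_trans _ _ (S X J)).
  rewrite /S big_seq [leRHS]big_seq_cond; under [leRHS]eq_bigl => x.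
    rewrite andb_idr; first over.
    move=> xX; apply: (leq_ltn_trans _ (ltn_expl J (ltnSn 1))).
    exact: (@leq_bigmax_seq _ (enum_fset X) xpredT (fun x : lattice N => graph_dist x 0) _ xX isT).
  exact: lexx.
apply: (le_trans (SJ X J)); rewrite ler_wpM2l ?ler0n// lerD2l ler_wpM2r ?invr_ge0 ?subr_ge0 ?(ltW rho1)//.
by rewrite gerBl exprn_ge0// ltW.
Qed.

End Summability.

Section NormPower.
Variable R : realType.
Implicit Types (p t : R).

(** For [p < 2] the formula is also right at 0, where both sides vanish. *)
Lemma is_derive_norm_powR p t : 1 < p ->
  is_derive t 1 (fun s : R => `|s| `^ p) (p * (`|t| `^ (p - 2) * t)).
Proof.
move=> p1; have p0 : 0 < p by lra.
have mul1 (r : R) : 0 < r -> r `^ (p - 2) * r = r `^ (p - 1).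
  move=> r0; rewrite -{2}(powRr1 (ltW r0)) -powRD ?(gt_eqF r0) ?implybT//.
  by congr (_ `^ _); lra.
have [t0|t0|->] := ltgtP t 0.
- apply: (@near_eq_is_derive _ _ _ ((@powR R ^~ p) \o -%R)).
    near=> s; rewrite /= ltr0_norm//; near: s; exact: lt_nbhsl.
  have nt : 0 < - t by rewrite oppr_gt0.
  have -> : p * (`|t| `^ (p - 2) * t) = p * (- t) `^ (p - 1) * -1.
    by rewrite ltr0_norm// -mul1//; ring.
  by apply: is_derive1_comp; exact: is_derive1_powR.
- apply: (@near_eq_is_derive _ _ _ (@powR R ^~ p)).
    near=> s; rewrite gtr0_norm//; near: s; exact: lt_nbhsr.
  by rewrite gtr0_norm// mul1//; exact: is_derive1_powR.
- rewrite mulr0 mulr0.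
  have H : h^-1 *: (((fun s : R => `|s| `^ p) \o shift (0:R)) (h *: (1:R)) - `|(0:R)| `^ p) @[h --> (0:R)^'] --> (0:R).
    apply/cvgrPdist_lt => e e0; near=> h.
    have h0 : h != 0 by near: h; exact: nbhs_dnbhs_neq.
    have hn : 0 < `|h| by rewrite normr_gt0.
    rewrite sub0r normrN normr0 powR0 ?gt_eqF// subr0 /= addr0 /GRing.scale/= mulr1.
    rewrite normrM normfV (ger0_norm (powR_ge0 _ _)) -(mulr_powRB1 (normr_ge0 h) p0).
    rewrite mulKf ?gt_eqF//.
    have he : `|h| < e `^ (p - 1)^-1 by near: h; apply: dnbhs0_lt; rewrite powR_gt0.
    have := gt0_ltr_powR (_ : 0 < p - 1) (normr_ge0 h : _ \in Num.nneg) (powR_ge0 _ _ : _ \in Num.nneg) he.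
    rewrite -powRrM mulVf ?powRr1 ?(ltW e0)//; first by apply; lra.
    by rewrite gt_eqF//; lra.
  by split; [exact: cvgP H|exact: cvg_lim H].
Unshelve. all: by end_near. Qed.

Lemma norm_powR_continuous p : 1 < p -> continuous (fun s : R => `|s| `^ p).
Proof.
move=> p1 s; apply/differentiable_continuous/derivable1_diffP.
by have [] := is_derive_norm_powR s p1.
Qed.

End NormPower.

(** * The energy space *)

Section EnergySpace.
Variables (R : realType) (N : nat).
Implicit Types (u v w : lattice N -> R) (x y z : lattice N) (p b q c : R).

Lemma energy_fsupp p u : p != 0 -> finitely_supported u ->
  exists E : R, energy p u = E%:E.
Proof.
move=> p0 fu; rewrite /energy esum_fsupp; first by eexists.
  by move=> x; exact: dens_ge0.
apply: (@sub_finite_set _ _ ([set x | u x != 0] `|` \bigcup_(y in [set y | u y != 0]) neighbors y)).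
  move=> x /= hx; have [ux|ux] := eqVneq (u x) 0; last by left.
  right; apply: contrapT => h; move/eqP: hx; apply.
  rewrite densE big_seq big1// => y; rewrite mem_nbhd => xy.
  have [uy|uy] := eqVneq (u y) 0; first by rewrite ux uy subrr normr0 powR0.
  by exfalso; apply: h; exists y => //; rewrite /neighbors/= neighborC.
rewrite finite_setU; split => //; apply: bigcup_finite => // y _.
exact: finite_neighbors.
Qed.

Lemma esumZ (T : choiceType) (f : T -> R) c : 0 < c -> (forall i, 0 <= f i) ->
  (\esum_(i in [set: T]) (c * f i)%:E = c%:E * \esum_(i in [set: T]) (f i)%:E)%E.
Proof.
have le_Z (g : T -> R) (k : R) : 0 < k -> (forall i, 0 <= g i) ->
    (\esum_(i in [set: T]) (k * g i)%:E <= k%:E * \esum_(i in [set: T]) (g i)%:E)%E.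
  move=> k0 g0; apply: ge_ereal_sup => _ [F [finF _] <-].
  rewrite fsumEFin// -mulr_fsumr EFinM lee_pmul2l//.
  apply: esum_ge; exists F; first by split.
  by rewrite fsumEFin.
move=> c0 f0; apply/eqP; rewrite eq_le le_Z//=.
have := le_Z (fun i => c * f i) c^-1.
rewrite invr_gt0 => /(_ c0 (fun i => mulr_ge0 (ltW c0) (f0 i))).
rewrite (eq_esum (b := fun i => (f i)%:E)); last first.
  by move=> i _; rewrite mulKf ?gt_eqF.
by rewrite lee_pdivlMl.
Qed.

Lemma densZ p c u x : 0 <= c -> dens p (fun x => c * u x) x = c `^ p * dens p u x.
Proof.
move=> c0; rewrite !densE mulr_sumr; apply: eq_bigr => y _.
by rewrite -mulrBr normrM ger0_norm// powRM.
Qed.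

Lemma energyZ p c u : 0 < c -> energy p (fun x => c * u x) = ((c `^ p)%:E * energy p u)%E.
Proof.
move=> c0; rewrite /energy -esumZ ?powR_gt0//; last by move=> x; exact: dens_ge0.
by apply: eq_esum => x _; rewrite densZ// ltW.
Qed.

Lemma massZ b q c u : 0 < c -> mass b q (fun x => c * u x) = ((c `^ q)%:E * mass b q u)%E.
Proof.
move=> c0; rewrite /mass -esumZ ?powR_gt0//; last by move=> x; exact: mass_term_ge0.
apply: eq_esum => x _; rewrite normrM (gtr0_norm c0) powRM ?(ltW c0)//.
by rewrite mulrCA.
Qed.

Lemma energy_abs p u : 0 <= p -> (energy p (fun x => `|u x|%R) <= energy p u)%E.
Proof.
move=> p0; apply: le_esum => x _; rewrite lee_fin !densE; apply: ler_sum => y _.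
by apply: ge0_ler_powR; rewrite ?nnegrE//; exact: ler_dist_dist.
Qed.

Lemma mass_abs b q u : mass b q (fun x => `|u x|) = mass b q u.
Proof. by apply: eq_esum => x _; rewrite normr_id. Qed.

Lemma fsuppZ c u : finitely_supported u -> finitely_supported (fun x => c * u x).
Proof.
by apply: sub_finite_set => x /=; apply: contraNneq => ->; rewrite mulr0.
Qed.

Lemma alignedZ c u : 0 <= c -> aligned u -> aligned (fun x => c * u x).
Proof. by move=> c0 au a x k ra h; rewrite ler_wpM2l//; exact: au. Qed.

(** A substitute for the Minkowski inequality: the factor of [`|a| `^ p] tends to 1
    with [t], so a perturbation that is small in energy changes the energy
    little. *)
Lemma norm_powR_split p (t a c : R) : 1 <= p -> 0 < t < 1 ->
  `|a + c| `^ p <= (1 - t) `^ (1 - p) * `|a| `^ p + t `^ (1 - p) * `|c| `^ p.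
Proof.
move=> p1 /andP[t0 t1].
have s0 : 0 < 1 - t by rewrite subr_gt0.
have := @norm_powR_convex R p t (c / t) (a / (1 - t)) p1.
rewrite (ltW t0) (ltW t1) => /(_ isT).
have k (r d : R) : 0 < r -> r * `|d / r| `^ p = r `^ (1 - p) * `|d| `^ p.
  move=> r0; rewrite normrM normfV (gtr0_norm r0) powRM ?invr_ge0 ?(ltW r0)//.
  rewrite powRB ?(gt_eqF r0) ?implybT// powRr1 ?(ltW r0)//.
  rewrite -(powR_inv1 (ltW r0)) -powRrM mulN1r powRN.
  by rewrite mulrA mulrAC.
rewrite !k// (mulrC t) divfK ?gt_eqF// (mulrC (1 - t)) divfK ?gt_eqF//.
by rewrite (addrC c) [leRHS]addrC.
Qed.

Lemma energy_split p (t : R) u v : 1 <= p -> 0 < t < 1 ->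
  (energy p (fun x => u x + v x)%R <=
   ((1 - t) `^ (1 - p))%:E * energy p u + (t `^ (1 - p))%:E * energy p v)%E.
Proof.
move=> p1 t01; have /andP[t0 t1] := t01.
rewrite /energy -!esumZ ?powR_gt0 ?subr_gt0//; [|by move=> x; exact: dens_ge0..].
rewrite -esumD; [|by move=> x _; rewrite lee_fin mulr_ge0 ?powR_ge0 ?dens_ge0..].
apply: le_esum => x _; rewrite -EFinD lee_fin !densE !mulr_sumr -big_split/=.
apply: ler_sum => y _.
by rewrite opprD addrACA; exact: norm_powR_split.
Qed.

Lemma dnormE p u : dnorm p u = ((energy p u) `^ p^-1)%E.
Proof. by []. Qed.

Lemma lnormE b q u : lnorm b q u = ((mass b q u) `^ q^-1)%E.
Proof. by []. Qed.

Lemma dnorm_powR p u : 0 < p -> (dnorm p u `^ p)%E = energy p u.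
Proof.
by move=> p0; rewrite dnormE -poweRrM mulVf ?gt_eqF// poweRe1// energy_ge0.
Qed.

Lemma lnorm1P b q u : 0 < q -> lnorm b q u = 1%E <-> mass b q u = 1%E.
Proof.
move=> q0; rewrite lnormE; split => [h|->]; last by rewrite poweR1r.
have := congr1 (fun e : \bar R => (e `^ q)%E) h.
by rewrite /= -poweRrM mulVf ?gt_eqF// poweRe1 ?mass_ge0// powR1.
Qed.

Lemma dnorm_cvg0 p (w : nat -> lattice N -> R) : 0 < p ->
  (dnorm p (w n) @[n --> \oo] --> 0%E) <->
  (forall e : R, 0 < e -> \forall n \near \oo, (energy p (w n) <= e%:E)%E).
Proof.
move=> p0; have q0 : 0 < p^-1 by rewrite invr_gt0.
split=> [/fine_cvgP[fin /cvgrPdist_le h] e e0|h].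
  near=> n.
  have fn : dnorm p (w n) \is a fin_num by near: n.
  have : `|0 - fine (dnorm p (w n))| <= e `^ p^-1 by near: n; apply: h; rewrite powR_gt0.
  rewrite sub0r normrN ger0_norm ?fine_ge0 ?poweR_ge0// => hn.
  rewrite -(dnorm_powR _ p0) -(fineK fn) poweR_EFin lee_fin.
  rewrite -[leRHS](@powRr1 _ e) ?(ltW e0)// -(mulVf (lt0r_neq0 p0)) powRrM.
  by apply: ge0_ler_powR; rewrite ?nnegrE ?powR_ge0 ?fine_ge0 ?poweR_ge0 ?(ltW p0).
apply/fine_cvgP; split.
  near=> n; have hn : (energy p (w n) <= 1%:E)%E by near: n; exact: h.
  apply: fin_num_poweR; rewrite ge0_fin_numE ?energy_ge0//.
  by apply: (le_lt_trans hn); exact: ltry.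
apply/cvgrPdist_le => e e0; near=> n.
have hn : (energy p (w n) <= (e `^ p)%:E)%E by near: n; apply: h; rewrite powR_gt0.
have fn : energy p (w n) \is a fin_num.
  by rewrite ge0_fin_numE ?energy_ge0//; apply: (le_lt_trans hn); exact: ltry.
rewrite sub0r normrN /= dnormE fine_poweR ger0_norm ?powR_ge0//.
rewrite -[leRHS](@powRr1 _ e) ?(ltW e0)// -(mulfV (lt0r_neq0 p0)) powRrM.
apply: ge0_ler_powR; rewrite ?nnegrE ?powR_ge0 ?fine_ge0 ?energy_ge0 ?invr_ge0 ?(ltW p0)//.
by rewrite -lee_fin fineK.
Unshelve. all: by end_near. Qed.

Lemma D0Z p c u : 0 < p -> 0 < c -> D0 p u -> D0 p (fun x => c * u x).
Proof.
move=> p0 c0 [w [fw wu]]; rewrite (dnorm_cvg0 _ p0) => dw.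
exists (fun n x => c * w n x); split.
- by move=> n; exact: fsuppZ.
- by move=> x; apply: cvgMr.
apply/(dnorm_cvg0 _ p0) => e e0.
have e0' : 0 < e / c `^ p by rewrite divr_gt0 ?powR_gt0.
apply: filterS (dw _ e0') => n.
rewrite (_ : (fun x => c * w n x - c * u x) = (fun x => c * (w n x - u x))); last first.
  by apply/funext => x; rewrite mulrBr.
rewrite energyZ// => h; rewrite (mulrC e) EFinM in h.
by rewrite lee_pdivlMl ?powR_gt0 in h.
Qed.

Lemma D0_delta p u x0 (s : R) : D0 p u -> D0 p (fun x => u x + s * (x == x0)%:R).
Proof.
move=> [w [fw wu dw]]; exists (fun n x => w n x + s * (x == x0)%:R); split.
- move=> n; apply: (@sub_finite_set _ _ ([set x | w n x != 0] `|` [set x0])).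
    move=> x /= h; have [->|nx] := eqVneq x x0; first by right.
    by left; move: h; rewrite (negbTE nx) mulr0 addr0.
  by rewrite finite_setU; split => //; exact: fw.
- by move=> x; apply: cvgD => //; exact: cvg_cst.
rewrite (_ : (fun n => _) = (fun n => dnorm p (fun x => w n x - u x)))//.
apply/funext => n; congr dnorm; apply/funext => x.
by rewrite opprD addrACA subrr addr0.
Qed.

Lemma near_natSinv (e : R) : 0 < e -> \forall n \near \oo, n.+1%:R^-1 <= e.
Proof.
move=> e0; have := near_infty_natSinv_lt (PosNum e0).
by apply: filterS => n /ltW.
Qed.

Lemma min_lipschitz (r d e : R) : 0 <= r -> 0 <= d -> 0 < e ->
  `|- Num.min d e - - Num.min r e| <= `|d - r| /\ `|- Num.min d e - - Num.min r e| <= e.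
Proof.
move=> r0 d0 e0; rewrite !ler_norml.
by case: (leP d e) => ?; case: (leP r e) => ?; case: (lerP 0 (d - r)) => h;
  rewrite ?(ger0_norm h) ?(ltr0_norm h); split; apply/andP; split; lra.
Qed.

Lemma sum_fset_sub (T : choiceType) (X Z : {fset T}) (f : T -> R) :
  (X `<=` Z)%fset -> \sum_(i <- Z | i \in X) f i = \sum_(i <- X) f i.
Proof.
move=> XZ; rewrite -big_filter; apply: perm_big; apply: uniq_perm.
- exact/filter_uniq/fset_uniq.
- exact: fset_uniq.
- by move=> i; rewrite mem_filter andb_idr// => /(fsubsetP XZ).
Qed.

(** The truncations max(u - 1/n, 0) are finitely supported and tend to [u]: their
    differences with [u] have edge increments bounded both by those of [u] and by
    1/n, so that dominated convergence gives the energy. *)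
Lemma D0_vanishing p u : 1 < p -> (forall x, 0 <= u x) ->
  (forall e, 0 < e -> finite_set [set x | e < u x]) ->
  (energy p u < +oo)%E -> D0 p u.
Proof.
move=> p1 u0 uv uE; have p0 : 0 < p by lra.
exists (fun n x => Num.max (u x - n.+1%:R^-1) 0).
have dE n x : Num.max (u x - n.+1%:R^-1) 0 - u x = - Num.min (u x) n.+1%:R^-1.
  by move: (u x) (n.+1%:R^-1) => a d; case: (leP (a - d) 0); case: (leP a d); lra.
have hn n : 0 < n.+1%:R^-1 :> R by rewrite invr_gt0 ltr0n.
split.
- move=> n; apply: sub_finite_set (uv _ (hn n)) => x /=.
  by case: (leP (u x - n.+1%:R^-1) 0) => [_|h _]; rewrite ?eqxx// -subr_gt0.
- move=> x; apply/cvgrPdist_le => e e0; near=> n.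
  have : n.+1%:R^-1 <= e by near: n; exact: near_natSinv.
  rewrite distrC dE normrN ger0_norm ?le_min ?u0 ?(ltW (hn n))//; apply: le_trans.
  by rewrite ge_min lexx orbT.
apply/(dnorm_cvg0 _ p0) => e e0.
have Efin : energy p u \is a fin_num by rewrite ge0_fin_numE ?energy_ge0.
pose E := fine (energy p u).
have EE : energy p u = E%:E by rewrite fineK.
have [X EX] : exists X : {fset lattice N}, E - e / 2 < \sum_(x <- X) dens p u x.
  apply: contrapT => /forallNP h.
  have : (energy p u <= (E - e / 2)%:E)%E.
    by apply/esum_leP => [x|X]; [exact: dens_ge0|rewrite leNgt; apply/negP; exact: h].
  by rewrite EE lee_fin; lra.
pose K : R := \sum_(x <- X) \sum_(y <- fset_set (neighbors x)) 1.
have K0 : 0 <= K by apply: sumr_ge0 => x _; apply: sumr_ge0.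
near=> n.
pose eps : R := n.+1%:R^-1.
(* eps^p K bounds the energy of the difference on X, up to the tail e / 2 *)
have small : eps `^ p * K <= e / 2.
  have : n.+1%:R^-1 <= (e / 2 / (K + 1)) `^ p^-1.
    near: n; apply: near_natSinv; rewrite powR_gt0// !divr_gt0//; lra.
  move=> /(@ge0_ler_powR R p (ltW p0) _ _ (ltW (hn n) : _ \in Num.nneg) (powR_ge0 _ _ : _ \in Num.nneg)).
  rewrite -powRrM mulVf ?gt_eqF// powRr1; last by rewrite !divr_ge0//; lra.
  rewrite ler_pdivlMr; last lra.
  have := powR_ge0 eps p; rewrite -/eps; nra.
pose v x := Num.max (u x - eps) 0 - u x.
have vd x y : `|v y - v x| <= `|u y - u x| /\ `|v y - v x| <= eps.
  by rewrite /v !dE -/eps; apply: min_lipschitz; [exact: u0|exact: u0|exact: hn].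
have dv_le x : dens p v x <= dens p u x.
  rewrite !densE; apply: ler_sum => y _.
  by apply: ge0_ler_powR; rewrite ?nnegrE ?(ltW p0)//; have [] := vd x y.
have dv_small x : dens p v x <= eps `^ p * \sum_(y <- fset_set (neighbors x)) 1.
  rewrite !densE mulr_sumr; apply: ler_sum => y _; rewrite mulr1.
  by apply: ge0_ler_powR; rewrite ?nnegrE ?(ltW p0) ?(ltW (hn n))//; have [] := vd x y.
apply/(esum_leP e) => [x|Y]; first exact: dens_ge0.
pose Z := (Y `|` X)%fset.
have ZE : \sum_(x <- Z) dens p u x <= E.
  by move: Z; apply/(esum_leP E) => [x|]; [exact: dens_ge0|rewrite -EE].
apply: (@le_trans _ _ (\sum_(x <- Z) dens p v x)).
  rewrite -(@sum_fset_sub _ Y Z); last exact: fsubsetUl.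
  rewrite [leRHS](bigID (mem Y))/= lerDl.
  by apply: sumr_ge0 => x _; exact: dens_ge0.
have XZ : (X `<=` Z)%fset by exact: fsubsetUr.
rewrite (bigID (fun x => x \in X))/= sum_fset_sub// in ZE.
rewrite (bigID (fun x => x \in X))/= sum_fset_sub//.
have h1 : \sum_(x <- X) dens p v x <= eps `^ p * K.
  by rewrite /K mulr_sumr; apply: ler_sum => x _; exact: dv_small.
have h2 : \sum_(x <- Z | x \notin X) dens p v x <= \sum_(x <- Z | x \notin X) dens p u x.
  by apply: ler_sum => x _; exact: dv_le.
lra.
Unshelve. all: by end_near. Qed.

End EnergySpace.

(** * Existence of an aligned minimizer *)

Section UltraLimits.
Variable R : realType.

(** Ultrafilters give the limit at all lattice points at once, without extraction
    of a diagonal subsequence. *)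
Lemma ultra_bounded_cvg (U : set_system nat) (UU : UltraFilter U) (f : nat -> R) (K : R) : (forall n, 0 <= f n <= K) ->
  exists l : R, f n @[n --> U] --> l.
Proof.
move=> fK; have [|l [_ cl]] := @segment_compact R 0 K (f n @[n --> U]) _.
  by apply: (@filterE _ U) => n; rewrite /= in_itv; exact: fK.
exists l => V Vl; have [//|UV] := in_ultra_setVsetC (f @^-1` V) UU.
by have [x []] := cl (~` V) V UV Vl.
Qed.

Lemma cvg_sum_seq (U : set_system nat) (UF : Filter U) (T : Type) (s : seq T) (f : nat -> T -> R) (g : T -> R) :
  (forall i, f n i @[n --> U] --> g i) ->
  \sum_(i <- s) f n i @[n --> U] --> \sum_(i <- s) g i.
Proof.
move=> fg; elim: s => [|i s IH].
  by rewrite big_nil; under eq_fun do rewrite big_nil; exact: cvg_cst.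
by rewrite big_cons; under eq_fun do rewrite big_cons; apply: cvgD.
Qed.

End UltraLimits.

Section Existence.
Variables (R : realType) (N : nat) (p b q : R).
Hypotheses (N1 : (1 <= N)%N) (p1 : 1 < p) (pN : p < N%:R) (b1 : -1 <= b) (b0 : b <= 0)
  (qq : qstar N p b < q) (qs1 : 1 < qstar N p b).
Implicit Types (u v w : lattice N -> R) (x y z : lattice N).

Local Notation alpha := (decay_exponent N p).
Local Notation beta := (q * (alpha - b)).

Let p0 : 0 < p := lt_trans ltr01 p1.
Let q1 : 1 < q := lt_trans qs1 qq.
Let q0 : 0 < q := lt_trans ltr01 q1.

Lemma alpha_gt0 : 0 < alpha.
Proof. exact: decay_exponent_gt0. Qed.

(** The supercritical hypothesis [q > qstar] is exactly the summability of the weight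
    times the q-th power of the decay profile. *)
Lemma exponent_gap : N%:R < beta.
Proof.
have Np : 0 < N%:R - p - p * b.
  by have := p0; have := pN; have := b0; nra.
have := qq; rewrite /qstar ltr_pdivrMr// => h.
rewrite -(ltr_pM2r p0) /decay_exponent.
rewrite (_ : q * (N%:R / p - 1 - b) * p = q * (N%:R - p - p * b))//.
by field; rewrite gt_eqF.
Qed.

Lemma p_lt_q : p < q.
Proof.
apply: le_lt_trans qq; have := pN; have := p0; have := b0; have := b1 => b1' b0' p0' pN'.
rewrite /qstar ler_pdivlMr; last by nra.
by nra.
Qed.

Definition decay x : R := (1 + (graph_dist x 0)%:R) `^ (- alpha).

Lemma mass_term_le u x (k : R) : 0 <= k -> 0 <= u x <= k * decay x ->
  mu (b * q) x * `|u x| `^ q <= k `^ q * (1 + (graph_dist x 0)%:R) `^ (- beta).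
Proof.
move=> k0 /andP[u0 uk]; rewrite ger0_norm//.
apply: (@le_trans _ _ (mu (b * q) x * (k * decay x) `^ q)).
  rewrite ler_pM2l ?mu_gt0//; apply: ge0_ler_powR; rewrite ?nnegrE ?(ltW q0)//.
  exact: le_trans uk.
have d0 : 0 < 1 + (graph_dist x 0)%:R :> R by rewrite ltr_pwDl.
rewrite powRM ?powR_ge0// /decay -powRrM mulrCA /mu -powRD ?(gt_eqF d0) ?implybT//.
by rewrite le_eqVlt; apply/orP; left; apply/eqP; congr (_ * _ `^ _); ring.
Qed.

Lemma mass_le : exists2 M : R, 0 < M & forall u (k : R), 0 <= k ->
  (forall x, 0 <= u x <= k * decay x) -> (mass b q u <= (k `^ q * M)%:E)%E.
Proof.
have [M hM] := @summable_dist R N beta exponent_gap.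
have M0 : 0 <= M by have := hM fset0; rewrite big_nil.
exists (M + 1) => [|u k k0 uk]; first by rewrite ltr_wpDl.
apply/esum_leP => [x|X]; first exact: mass_term_ge0.
apply: (@le_trans _ _ (\sum_(x <- X) k `^ q * (1 + (graph_dist x 0)%:R) `^ (- beta))).
  by apply: ler_sum => x _; exact: mass_term_le.
rewrite -mulr_sumr ler_wpM2l ?powR_ge0//.
by apply: (le_trans (hM X)); rewrite lerDl.
Qed.

(** Below a common decay profile the mass is uniformly concentrated on a finite
    set; this is the compactness of the embedding. *)
Lemma mass_tail (k e : R) : 0 <= k -> 0 < e -> exists X : {fset lattice N},
  forall u, (forall x, 0 <= u x <= k * decay x) ->
  (mass b q u <= (\sum_(x <- X) mu (b * q) x * `|u x| `^ q + e)%:E)%E.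
Proof.
move=> k0 e0; have [M hM] := @summable_dist R N beta exponent_gap.
pose f x : R := k `^ q * (1 + (graph_dist x 0)%:R) `^ (- beta).
have f0 x : 0 <= f x by rewrite mulr_ge0 ?powR_ge0.
have fM : (\esum_(x in [set: lattice N]) (f x)%:E <= (k `^ q * M)%:E)%E.
  apply/esum_leP => // X; rewrite -mulr_sumr ler_wpM2l ?powR_ge0//.
have Ffin : \esum_(x in [set: lattice N]) (f x)%:E \is a fin_num.
  rewrite ge0_fin_numE ?(le_lt_trans fM) ?ltry//.
  by apply: esum_ge0 => x _; rewrite lee_fin.
pose E := fine (\esum_(x in [set: lattice N]) (f x)%:E).
have EE : \esum_(x in [set: lattice N]) (f x)%:E = E%:E by rewrite fineK.
have [X EX] : exists X : {fset lattice N}, E - e < \sum_(x <- X) f x.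
  apply: contrapT => /forallNP h.
  have : (\esum_(x in [set: lattice N]) (f x)%:E <= (E - e)%:E)%E.
    by apply/esum_leP => // X; rewrite leNgt; apply/negP; exact: h.
  by rewrite EE lee_fin; lra.
exists X => u uk; apply/esum_leP => [x|Y]; first exact: mass_term_ge0.
pose Z := (Y `|` X)%fset.
have ZE : \sum_(x <- Z) f x <= E.
  by move: Z; apply/(esum_leP E) => //; rewrite -EE.
apply: (@le_trans _ _ (\sum_(x <- Z) mu (b * q) x * `|u x| `^ q)).
  rewrite -(@sum_fset_sub _ _ Y Z); last exact: fsubsetUl.
  rewrite [leRHS](bigID (fun x => x \in Y))/= lerDl.
  by apply: sumr_ge0 => x _; exact: mass_term_ge0.
have XZ : (X `<=` Z)%fset by exact: fsubsetUr.
rewrite (bigID (fun x => x \in X))/= sum_fset_sub// in ZE.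
rewrite (bigID (fun x => x \in X))/= sum_fset_sub// lerD2l.
apply: (@le_trans _ _ (\sum_(x <- Z | x \notin X) f x)); last by lra.
by apply: ler_sum => x _; exact: mass_term_le.
Qed.

Definition competitor w : Prop :=
  [/\ forall x, 0 <= w x, finitely_supported w, aligned w & (1 <= mass b q w)%E].

(** Symmetrize the indicator of the origin, which has mass 1. *)
Lemma exists_competitor : exists w, competitor w.
Proof.
pose d x : R := (x == 0)%:R.
have [||w [w0 fw aw _ mw]] := @symmetrize R N p b q d (ltW p1) b0 (ltW q0).
- by move=> x; rewrite ler0n.
- apply: sub_finite_set (finite_set1 (0 : lattice N)) => x /=.
  by rewrite /d; case: (eqVneq x 0) => //; rewrite eqxx.
exists w; split => //; apply: le_trans mw.
apply: esum_ge; exists [set 0]; first by split.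
rewrite fsbig_set1 /d eqxx normr1 powR1 mulr1 lee_fin /mu.
suff -> : graph_dist (0 : lattice N) 0 = 0%N by rewrite addr0 powR1.
apply/eqP; rewrite -eqz_nat graph_dist_l1 /l1 big1// => i _.
by rewrite mxE normr0.
Qed.

Definition aligned_inf : \bar R := ereal_inf [set energy p w | w in competitor].

Local Notation I := aligned_inf.
Local Notation I0 := (fine aligned_inf).

Lemma I_fin : I \is a fin_num.
Proof.
rewrite ge0_fin_numE.
  have [w cw] := exists_competitor; have [_ fw _ _] := cw.
  have [E wE] := energy_fsupp (lt0r_neq0 p0) fw.
  apply: (@le_lt_trans _ _ E%:E); last exact: ltry.
  by rewrite -wE; apply: ereal_inf_lbound; exists w.
by apply: le_ereal_inf_tmp => _ [w _ <-]; exact: energy_ge0.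
Qed.

Lemma I0E : I = I0%:E.
Proof. by rewrite fineK// I_fin. Qed.

Lemma I0_le w : competitor w -> (I0%:E <= energy p w)%E.
Proof. by move=> cw; rewrite -I0E; apply: ereal_inf_lbound; exists w. Qed.

(** A competitor of small energy would, by the decay estimate, have mass less
    than 1. *)
Lemma I0_gt0 : 0 < I0.
Proof.
have [i0] : exists i0 : 'I_N, True by exists (Ordinal N1).
move=> _; have [C C0 hC] := @decay_pointwise R N p i0 p1 pN.
have [M M0 hM] := mass_le.
(* the energy for which the decay estimate bounds the mass by 1/2 *)
pose E : R := ((2 * M)^-1 `^ q^-1 / C) `^ p.
have M20 : 0 < (2 * M)^-1 by rewrite invr_gt0 mulr_gt0.
have E0 : 0 < E by rewrite powR_gt0// divr_gt0// powR_gt0.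
apply: (lt_le_trans E0); rewrite -lee_fin -I0E.
apply: le_ereal_inf_tmp => _ [w [w0 fw aw mw] <-].
rewrite leNgt; apply/negP => wE.
have : (mass b q w <= ((C * E `^ p^-1) `^ q * M)%:E)%E.
  apply: hM; first by rewrite mulr_ge0 ?powR_ge0 ?ltW.
  by move=> x; rewrite w0/=; exact: (hC w E aw fw E0 (ltW wE) x).
move=> /(le_trans mw); rewrite lee_fin.
rewrite /E -powRrM mulfV ?gt_eqF// powRr1; last by rewrite divr_ge0 ?powR_ge0// ltW.
rewrite (mulrC C) divfK ?gt_eqF// -powRrM mulVf ?gt_eqF// powRr1 ?(ltW M20)//.
by rewrite invfM -mulrA mulVf ?gt_eqF// mulr1; lra.
Qed.

Lemma cvg_mass_term (U : set_system nat) (UF : Filter U) (w : nat -> lattice N -> R) u x :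
  w n x @[n --> U] --> u x ->
  mu (b * q) x * `|w n x| `^ q @[n --> U] --> mu (b * q) x * `|u x| `^ q.
Proof.
move=> wu; apply: cvgMr.
exact: (cvg_comp _ (fun s : R => `|s| `^ q) wu (@norm_powR_continuous R q q1 _)).
Qed.

Lemma cvg_dens (U : set_system nat) (UF : Filter U) (w : nat -> lattice N -> R) u x :
  (forall x, w n x @[n --> U] --> u x) ->
  dens p (w n) x @[n --> U] --> dens p u x.
Proof.
move=> wu; under eq_fun do rewrite densE; rewrite densE; apply: cvg_sum_seq => y.
apply: (cvg_comp _ (fun s : R => `|s| `^ p) _ (@norm_powR_continuous R p p1 _)).
exact: cvgB.
Qed.

Lemma mass_gt_finite u (m : R) : (m%:E < mass b q u)%E ->
  exists X : {fset lattice N}, m < \sum_(x <- X) mu (b * q) x * `|u x| `^ q.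
Proof.
move=> mu_; apply: contrapT => /forallNP h; move: mu_; rewrite ltNge => /negP; apply.
apply/esum_leP => [x|X]; first exact: mass_term_ge0.
by rewrite leNgt; apply/negP; exact: h.
Qed.

Lemma sum_le_mass u (X : {fset lattice N}) :
  ((\sum_(x <- X) mu (b * q) x * `|u x| `^ q)%:E <= mass b q u)%E.
Proof.
have [[M|//|] mE] : exists m, mass b q u = m by eexists.
- by rewrite mE lee_fin; move: X; apply/esum_leP => [x|]; [exact: mass_term_ge0|rewrite -mE].
- by rewrite mE leey.
by have := mass_ge0 b q u; rewrite mE.
Qed.

(** An arbitrary admissible function is approximated by finitely supported ones,
    whose symmetrizations multiplied by l^(1/p) are competitors; the factor l > 1
    pays both for the mass lost in the approximation and for the loss in
    [energy_split]. *)
Lemma compare_step v (Ev l : R) : D0 p v -> mass b q v = 1%E -> energy p v = Ev%:E ->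
  1 < l -> I0 <= l * (l * Ev).
Proof.
move=> [w [fw wv]]; rewrite (dnorm_cvg0 _ p0) => dw mv vE l1.
have l0 : 0 < l by apply: lt_trans l1.
(* t solves (1 - t)^(1 - p) = l *)
pose t : R := 1 - l `^ (- (p - 1)^-1).
have pow_lt1 (r : R) : 0 < r -> l `^ (- r) < 1.
  move=> r0; rewrite powRN invf_lt1 ?powR_gt0//.
  by have := @gt0_ltr_powR R r r0 1 l; rewrite powR1; apply; rewrite ?nnegrE ?ltW.
have p10 : 0 < p - 1 by rewrite subr_gt0.
have t01 : 0 < t < 1.
  by rewrite /t subr_gt0 pow_lt1 ?invr_gt0//= gtrBl powR_gt0.
have tl : (1 - t) `^ (1 - p) = l.
  rewrite /t subKr -powRrM -(opprB p 1) mulrNN mulVf ?gt_eqF// powRr1 ?ltW//.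
pose m : R := l `^ (- (q / p)).
have m1 : m < 1 by rewrite pow_lt1// divr_gt0.
have [X mX] : exists X : {fset lattice N}, m < \sum_(x <- X) mu (b * q) x * `|v x| `^ q.
  by apply: mass_gt_finite; rewrite mv lte_fin.
suff H (e : R) : 0 < e -> I0 <= l * (l * Ev + t `^ (1 - p) * e).
  apply/ler_addgt0Pr => e e0.
  have k0 : 0 < l * t `^ (1 - p) by rewrite mulr_gt0// powR_gt0; case/andP: t01.
  have := H (e / (l * t `^ (1 - p))) (divr_gt0 e0 k0).
  by rewrite mulrDr [l * (t `^ _ * _)]mulrA [_ * (e / _)]mulrC divfK ?gt_eqF.
move=> e0.
have [n [mn en]] : exists n, m < \sum_(x <- X) mu (b * q) x * `|w n x| `^ q /\
    (energy p (fun x => w n x - v x)%R <= e%:E)%E.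
  apply: (@filter_ex _ \oo); apply: filterI; last exact: dw.
  have cv : \sum_(x <- X) mu (b * q) x * `|w n x| `^ q @[n --> \oo] -->
      \sum_(x <- X) mu (b * q) x * `|v x| `^ q.
    by apply: cvg_sum_seq => x; exact: cvg_mass_term.
  exact: (cvgr_gt _ cv _ mX).
have [||w' [w'0 fw' aw' ew' mw']] :=
    @symmetrize R N p b q (fun x => `|w n x|) (ltW p1) b0 (ltW q0).
- by move=> x.
- by apply: sub_finite_set (fw n) => x /=; rewrite normr_eq0.
pose c : R := l `^ p^-1.
have c0 : 0 < c by rewrite powR_gt0.
have comp : competitor (fun x => c * w' x).
  split.
  - by move=> x; rewrite mulr_ge0// ltW.
  - exact: fsuppZ.
  - exact: alignedZ (ltW c0) aw'.
  - rewrite massZ//; apply: (@le_trans _ _ ((c `^ q)%:E * m%:E)%E).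
      rewrite -EFinM lee_fin /c /m -powRrM -powRD ?(gt_eqF l0) ?implybT//.
      by rewrite mulrC subrr powRr0.
    rewrite lee_pmul2l ?lte_fin ?powR_gt0//; apply: le_trans mw'.
    rewrite mass_abs; apply: le_trans (sum_le_mass (w n) X).
    by rewrite lee_fin ltW.
have := I0_le comp; rewrite energyZ// /c -powRrM mulVf ?gt_eqF// powRr1 ?(ltW l0)// => h.
rewrite -lee_fin; apply: (le_trans h); rewrite EFinM lee_pmul2l//.
apply: (le_trans ew'); apply: (le_trans (energy_abs _ (ltW p0))).
have -> : w n = (fun x => v x + (w n x - v x)) by apply/funext => x; rewrite subrKC.
apply: (le_trans (energy_split _ _ (ltW p1) t01)).
rewrite tl vE EFinD EFinM leeD2l// EFinM lee_pmul2l ?lte_fin ?powR_gt0//.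
by case/andP: t01.
Qed.

Lemma compare v : D0 p v -> mass b q v = 1%E -> (I0%:E <= energy p v)%E.
Proof.
move=> Dv mv; have [[Ev|//|] vE] : exists m, energy p v = m by eexists.
- rewrite vE lee_fin leNgt; apply/negP => lt_I.
  have E0 : 0 <= Ev by rewrite -lee_fin -vE energy_ge0.
  have I00 := I0_gt0.
  have h (l : R) : 1 < l -> I0 <= l * (l * Ev) by exact: (compare_step Dv mv vE).
  pose d := Num.min 1 ((I0 - Ev) / (4 * (Ev + 1))).
  have d0 : 0 < d by rewrite lt_min ltr01 divr_gt0//; lra.
  have d1 : d <= 1 by rewrite ge_min lexx.
  have d2 : d * (4 * (Ev + 1)) <= I0 - Ev.
    rewrite -ler_pdivlMr; first by rewrite ge_min lexx orbT.
    by lra.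
  have := h (1 + d) _; rewrite ltrDl => /(_ d0); nra.
- by rewrite vE leey.
by have := energy_ge0 p v; rewrite vE.
Qed.

(** The pointwise limit of a minimizing sequence of competitors along an
    ultrafilter: the decay estimate makes the sequence bounded at each point and
    its mass uniformly concentrated, so that no mass is lost, while the energy is
    lower semicontinuous. *)
Lemma limit_profile : exists u (K : R), [/\ 0 <= K, forall x, 0 <= u x <= K * decay x,
  aligned u, (energy p u <= I0%:E)%E & (1 <= mass b q u)%E].
Proof.
have /boolp.choice[w hw] : forall n : nat, exists w, competitor w /\
    (energy p w <= (I0 + n.+1%:R^-1)%:E)%E.
  move=> n.
  have n0 : 0 < n.+1%:R^-1 :> R by rewrite invr_gt0.
  have [_ [w cw <-] wE] := lb_ereal_inf_adherent n0 I_fin.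
  by exists w; split => //; rewrite ltW// EFinD -I0E.
have [i0 _] : exists i0 : 'I_N, True by exists (Ordinal N1).
have [C C0 hC] := @decay_pointwise R N p i0 p1 pN.
have E0 : 0 < I0 + 1 by rewrite addr_gt0 ?I0_gt0.
pose K : R := C * (I0 + 1) `^ p^-1.
have K0 : 0 <= K by rewrite mulr_ge0 ?powR_ge0// ltW.
have wK n x : 0 <= w n x <= K * decay x.
  have [[w0 fw aw _] wE] := hw n.
  rewrite w0/=; apply: (hC (w n) (I0 + 1) aw fw E0) => //.
  apply: (le_trans wE); rewrite lee_fin lerD2l invf_le1 ?ltr0n//.
  by rewrite ler1n.
have [U [UU Uoo]] := ultraFilterLemma (_ : ProperFilter \oo).
have /boolp.choice[u wu] : forall x, exists l : R, w n x @[n --> U] --> l.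
  move=> x.
  by apply: (@ultra_bounded_cvg _ _ _ _ (K * decay x)) => n; exact: wK.
have uK x : 0 <= u x <= K * decay x.
  apply/andP; split.
    by apply: (cvgr_to_ge (wu x)); apply: filterE => n; case/andP: (wK n x).
  by apply: (cvgr_to_le (wu x)); apply: filterE => n; case/andP: (wK n x).
exists u, K; split => //.
- move=> a x c ra h; apply: (ler_cvg_to (wu _) (wu _)).
  by apply: filterE => n; have [[_ _ aw _] _] := hw n; exact: aw.
- apply/esum_leP => [x|X]; first exact: dens_ge0.
  apply/ler_addgt0Pr => e e0.
  have cv : \sum_(x <- X) dens p (w n) x @[n --> U] --> \sum_(x <- X) dens p u x.
    by apply: cvg_sum_seq => x; exact: cvg_dens.
  apply: (cvgr_to_le cv); apply: Uoo; near=> n.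
  apply: (@le_trans _ _ (I0 + n.+1%:R^-1)).
    have [_ wE] := hw n.
    by move: X {cv}; apply/esum_leP => // x; exact: dens_ge0.
  by rewrite lerD2l; near: n; exact: near_natSinv.
- apply/lee_addgt0Pr => e e0.
  have [X hX] := mass_tail K0 e0.
  have cv : \sum_(x <- X) mu (b * q) x * `|w n x| `^ q @[n --> U] -->
      \sum_(x <- X) mu (b * q) x * `|u x| `^ q.
    by apply: cvg_sum_seq => x; exact: cvg_mass_term.
  have : 1 - e <= \sum_(x <- X) mu (b * q) x * `|u x| `^ q.
    apply: (cvgr_to_ge cv); apply: filterE => n.
    have [[_ _ _ mw] _] := hw n.
    by have := le_trans mw (hX _ (wK n)); rewrite lee_fin lerBlDr.
  rewrite lerBlDr -lee_fin => h; apply: (le_trans h).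
  by rewrite EFinD leeD2r// sum_le_mass.
Unshelve. all: by end_near. Qed.

Lemma decay_superlevel (K e : R) : 0 < e -> finite_set [set x | e < K * decay x].
Proof.
move=> e0; have a0 := alpha_gt0.
apply: sub_finite_set (@finite_ball N (Num.truncn ((`|K| / e) `^ alpha^-1))) => x /= h.
have d0 : 0 < 1 + (graph_dist x 0)%:R :> R by rewrite ltr_pwDl.
have : e < `|K| * decay x.
  by apply: lt_le_trans h _; rewrite ler_wpM2r ?powR_ge0// ler_norm.
rewrite /decay powRN ltr_pdivlMr ?powR_gt0// mulrC -ltr_pdivlMr// => {}h.
have Ke : 0 <= `|K| / e by rewrite divr_ge0// ltW.
have := gt0_ltr_powR (_ : 0 < alpha^-1) (powR_ge0 _ _ : _ \in Num.nneg) (Ke : _ \in Num.nneg) h.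
rewrite invr_gt0 => /(_ a0); rewrite -powRrM mulfV ?gt_eqF// powRr1 ?(ltW d0)// => {}h.
rewrite truncn_ge_nat ?powR_ge0//; apply: le_trans (ltW h).
by rewrite lerDr.
Qed.

(** Dividing the limit profile by its norm, which is at least 1, gives mass 1 without
    increasing the energy. *)
Theorem exists_minimizer : exists v (I1 : R),
  [/\ 0 < I1, minimizer p b q v, C0plus v, aligned v &
  energy p v = I1%:E /\ forall w, D0 p w -> mass b q w = 1%E -> (I1%:E <= energy p w)%E].
Proof.
have [u [K [K0 uK au uE mu1]]] := limit_profile.
have [M0 M00 hM] := mass_le.
have [M mM] : exists M : R, mass b q u = M%:E.
  exists (fine (mass b q u)); rewrite fineK// ge0_fin_numE ?mass_ge0//.
  by apply: (le_lt_trans (hM u K K0 uK)); exact: ltry.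
have M1 : 1 <= M by rewrite -lee_fin -mM.
have Mgt0 : 0 < M by apply: lt_le_trans M1.
pose c : R := M `^ (- q^-1).
have c0 : 0 < c by rewrite powR_gt0.
pose v x := c * u x.
have mv : mass b q v = 1%E.
  rewrite massZ// mM -EFinM /c -powRrM mulNr mulVf ?gt_eqF//.
  by rewrite powR_inv1 ?(ltW Mgt0)// mulVf ?gt_eqF.
have vE : (energy p v <= I0%:E)%E.
  rewrite energyZ//; apply: le_trans uE.
  have : c `^ p <= 1.
    rewrite /c -powRrM mulNr powRN invf_le1 ?powR_gt0//.
    rewrite -[leLHS](powRr0 M); apply: ler_powR => //.
    by rewrite mulr_ge0 ?invr_ge0 ?ltW.
  rewrite -lee_fin => /(lee_wpmul2r (energy_ge0 p u)).
  by rewrite mul1e.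
have v0 x : 0 <= v x by rewrite mulr_ge0 ?(ltW c0)//; case/andP: (uK x).
have cv : C0plus v.
  split=> // t t0; apply: sub_finite_set (decay_superlevel (c * K) t0) => x /= h.
  by apply: (lt_le_trans h); rewrite -mulrA ler_wpM2l ?(ltW c0)//; case/andP: (uK x).
have Dv : D0 p v.
  apply: D0_vanishing => //; first by case: cv.
  by apply: (le_lt_trans vE); exact: ltry.
have vI : energy p v = I0%:E.
  by apply/eqP; rewrite eq_le vE compare.
exists v, I0; split => //; first exact: I0_gt0; last 2 first.
- exact: alignedZ (ltW c0) au.
- by split => // w; exact: compare.
split; first by split => //; apply/lnorm1P.
apply/eqP; rewrite eq_le; apply/andP; split.
  apply: le_ereal_inf_tmp => _ [w [Dw /(lnorm1P _ _ q0) mw] <-].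
  by rewrite !dnorm_powR// vI; exact: compare.
apply: ereal_inf_lbound; exists v => //.
by split => //; apply/lnorm1P.
Qed.

End Existence.

(** * The Euler-Lagrange equation *)

Section EulerLagrange.
Variables (R : realType) (N : nat).
Implicit Types (u v w : lattice N -> R) (x y z : lattice N) (p b q s t : R).

Lemma is_derive_sum_seq (T : Type) (r : seq T) (f : T -> R -> R) (df : T -> R) (t : R) :
  (forall i, is_derive t 1 (f i) (df i)) ->
  is_derive t 1 (fun s => \sum_(i <- r) f i s) (\sum_(i <- r) df i).
Proof.
move=> fd; elim: r => [|i r IH].
  by rewrite big_nil; under eq_fun do rewrite big_nil; exact: is_derive_cst.
rewrite big_cons; under eq_fun do rewrite big_cons.
exact: (is_deriveD (fd i) IH).
Qed.

Lemma is_derive_affine_norm p (a k t : R) : 1 < p ->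
  is_derive t 1 (fun s : R => `|a + s * k| `^ p)
    (p * (`|a + t * k| `^ (p - 2) * (a + t * k)) * k).
Proof.
move=> p1; apply: (@is_derive1_comp _ (fun s : R => `|s| `^ p) (fun s => a + s * k)).
  exact: is_derive_norm_powR.
have -> : k = 0 + (t *: 0 + k *: 1) by rewrite scaler0 !add0r /GRing.scale/= mulr1.
have h : is_derive t (1 : R) ((cst a) + (id * cst k))  (0 + (t *: 0 + k *: 1) : R).
  by apply: is_deriveD; apply: is_deriveM.
by move: h; rewrite scaler0 !add0r /GRing.scale/= mulr1.
Qed.

Lemma is_derive_scale_shift (f : R -> R) (a k c t df : R) : is_derive t 1 f df ->
  is_derive t 1 (fun s => a + k * (f s - c)) (k * df).
Proof.
move=> fd.
have := is_deriveD (is_derive_cst a t 1)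
  (is_deriveZ k (is_deriveB fd (is_derive_cst c t 1))).
by rewrite add0r subr0.
Qed.

Lemma critical_point (f df : R -> R) (d : R) : 0 < d ->
  (forall t, `|t| < d -> is_derive t 1 f (df t)) -> f 0 = 0 ->
  (forall t, `|t| < d -> 0 <= f t) -> df 0 = 0.
Proof.
move=> d0 fd f0 f_ge0.
have in_d t : t \in `]- d, d[ -> `|t| < d by rewrite in_itv/= ltr_norml.
have dd : - d <= d by lra.
have d_in : 0 \in `]- d, d[ by rewrite in_itv/= d0 andbT oppr_lt0.
have [_ e1] : is_derive (0 : R) (1 : R) f 0.
  apply: (derive1_at_min dd) d_in _ => t /in_d td; last by rewrite f0; exact: f_ge0.
  by have [] := fd t td.
by have [_ <-] := fd 0 (in_d _ d_in); rewrite e1.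
Qed.

Lemma esum_change (T : choiceType) (X : {fset T}) (f g : T -> R) (F : R) :
  (forall i, 0 <= f i) -> (forall i, 0 <= g i) -> (forall i, i \notin X -> f i = g i) ->
  (\esum_(i in [set: T]) (f i)%:E = F%:E)%E ->
  (\esum_(i in [set: T]) (g i)%:E = (F + \sum_(i <- X) (g i - f i)%R)%:E)%E.
Proof.
move=> f0 g0 fg fF.
have on (h : T -> R) : (forall i, 0 <= h i) ->
    (\esum_(i in [set: T]) (if i \in X then h i else 0)%:E = (\sum_(i <- X) h i)%:E)%E.
  move=> h0; have -> : \sum_(i <- X) h i = \sum_(i \in [set` X]) h i.
    by rewrite fsbig_finite// set_fsetK.
  rewrite -fsumEFin// -esum_fset//.
    rewrite [RHS]esum_mkcond; apply: eq_esum => i _.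
    have [iX|iX] := boolP (i \in X); first by rewrite mem_set.
    by rewrite memNset//; apply/negP.
  by move=> i _; rewrite lee_fin.
have e : (\esum_(i in [set: T]) ((g i)%:E + (if i \in X then f i else 0)%:E) =
          \esum_(i in [set: T]) ((f i)%:E + (if i \in X then g i else 0)%:E))%E.
  apply: eq_esum => i _; rewrite -!EFinD.
  by have [_|/fg ->//] := boolP (i \in X); rewrite addrC.
rewrite !esumD in e; try by move=> i _; rewrite lee_fin; try case: ifP.
rewrite !on// fF in e.
case: (\esum_(i in _) (g i)%:E)%E e => //= G [e].
by rewrite sumrB addrA -e addrK.
Qed.

Lemma sum_delta_nbhd x y (F : lattice N -> R) :
  \sum_(z <- fset_set (neighbors x)) F z * (z == y)%:R = if neighbor x y then F y else 0.
Proof.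
rewrite -mem_nbhd; case: ifP => [yx|/negbT yx].
  rewrite (big_rem y)//= eqxx mulr1 big_seq big1 ?addr0// => z.
  by rewrite mem_rem_uniq ?fset_uniq// inE => /andP[/negbTE -> _]; rewrite mulr0.
rewrite big_seq big1// => z zx; case: eqP => [e|]; last by rewrite mulr0.
by rewrite -e zx in yx.
Qed.

Lemma plaplacianE p u x :
  plaplacian p u x = \sum_(y <- fset_set (neighbors x)) `|u y - u x| `^ (p - 2) * (u y - u x).
Proof. by rewrite /plaplacian fsbig_finite//; exact: finite_neighbors. Qed.

(** The points where moving the value at [x] changes the energy density. *)
Definition star_nbhd x : {fset lattice N} := (x |` fset_set (neighbors x))%fset.

(** Each edge at [x] occurs twice in the energy, once from either end, and both
    occurrences have the same derivative. *)
Lemma energy_gradient p v x :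
  \sum_(z <- star_nbhd x) \sum_(y <- fset_set (neighbors z))
     p * (`|v y - v z| `^ (p - 2) * (v y - v z)) * ((y == x)%:R - (z == x)%:R) =
  - (2 * p * plaplacian p v x).
Proof.
pose G z y := `|v y - v z| `^ (p - 2) * (v y - v z).
have GC z y : G y z = - G z y by rewrite /G distrC -mulrN opprB.
transitivity (p * (\sum_(z <- star_nbhd x) (if neighbor z x then G z x else 0) -
                   \sum_(z <- star_nbhd x) (z == x)%:R * plaplacian p v z)).
  rewrite -sumrB mulr_sumr; apply: eq_bigr => z _.
  rewrite -(sum_delta_nbhd z x (G z)) plaplacianE mulr_sumr -sumrB mulr_sumr.
  by apply: eq_bigr => y _; rewrite /G; ring.
have -> : \sum_(z <- star_nbhd x) (z == x)%:R * plaplacian p v z = plaplacian p v x.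
  rewrite (big_rem x)/=; last by rewrite in_fset1U eqxx.
  rewrite eqxx mul1r big_seq big1 ?addr0// => z.
  by rewrite mem_rem_uniq ?fset_uniq// inE => /andP[/negbTE -> _]; rewrite mul0r.
have -> : \sum_(z <- star_nbhd x) (if neighbor z x then G z x else 0) = - plaplacian p v x.
  rewrite -big_mkcond/=.
  under eq_bigl do rewrite neighborC -mem_nbhd.
  rewrite sum_fset_sub ?fsubsetU1// plaplacianE -sumrN.
  by apply: eq_bigr => z _; rewrite GC.
ring.
Qed.

(** The term 0 * 1 is written so that the right-hand side at [s = 0] is visibly 1. *)
Lemma mass_shift b q v x s : mass b q v = 1%E ->
  mass b q (fun y => v y + s * (y == x)%:R) =
  (1 + mu (b * q) x * (`|v x + s * 1| `^ q - `|v x + 0 * 1| `^ q))%:E.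
Proof.
move=> mv; rewrite /mass (@esum_change _ [fset x]%fset
    (fun y => mu (b * q) y * `|v y| `^ q) _ 1) ?big_seq_fset1 ?eqxx ?mul0r ?addr0 ?mulrBr//.
- by move=> y; rewrite mulr_ge0 ?powR_ge0 ?(ltW (mu_gt0 _ _)).
- by move=> y; rewrite mulr_ge0 ?powR_ge0 ?(ltW (mu_gt0 _ _)).
- by move=> y; rewrite inE => /negbTE ->; rewrite mulr0 addr0.
Qed.

Lemma energy_shift p v x s (E : R) : energy p v = E%:E ->
  energy p (fun y => v y + s * (y == x)%:R) =
  (E + \sum_(z <- star_nbhd x) \sum_(y <- fset_set (neighbors z))
    (`|(v y - v z) + s * ((y == x)%:R - (z == x)%:R)| `^ p - `|v y - v z| `^ p))%:E.
Proof.
move=> vE; rewrite /energy (@esum_change _ (star_nbhd x) (dens p v) _ E)//.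
- congr (_ + _)%:E; apply: eq_bigr => z _; rewrite !densE -sumrB.
  by apply: eq_bigr => y _; rewrite mulrBr opprD addrACA.
- by move=> z; exact: dens_ge0.
- by move=> z; exact: dens_ge0.
move=> z; rewrite in_fset1U negb_or mem_nbhd => /andP[/negbTE zx nzx].
rewrite !densE big_seq [RHS]big_seq; apply: eq_bigr => y; rewrite mem_nbhd => zy.
have /negbTE yx : y != x by apply: contraNneq nzx => <-; rewrite neighborC.
by rewrite yx zx !mulr0 !addr0.
Qed.

(** Vary the value at one point [x] by [s] and normalize: by homogeneity
    [I * mass^(p/q) <= energy] holds for small [s], with equality at 0, so the
    derivatives of both sides agree there. *)
Lemma euler_lagrange p b q v (I : R) : 1 < p -> 1 < q -> (forall x, 0 <= v x) ->
  D0 p v -> mass b q v = 1%E -> energy p v = I%:E ->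
  (forall w, D0 p w -> mass b q w = 1%E -> (I%:E <= energy p w)%E) ->
  forall x, plaplacian p v x + I / 2 * (mu (b * q) x * v x `^ (q - 1)) = 0.
Proof.
move=> p1 q1 v0 Dv mv vE vmin x.
have p0 : 0 < p by lra.
have q0 : 0 < q by lra.
pose beta s : R := 1 + mu (b * q) x * (`|v x + s * 1| `^ q - `|v x + 0 * 1| `^ q).
pose eps s : R := \sum_(z <- star_nbhd x) \sum_(y <- fset_set (neighbors z))
    (`|(v y - v z) + s * ((y == x)%:R - (z == x)%:R)| `^ p - `|v y - v z| `^ p).
pose phi s : R := (I + eps s) - I * beta s `^ (p / q).
have dbeta t : is_derive t 1 beta
    (mu (b * q) x * (q * (`|v x + t * 1| `^ (q - 2) * (v x + t * 1)) * 1)).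
  by apply: is_derive_scale_shift; exact: is_derive_affine_norm.
have deps t : is_derive t 1 eps
    (\sum_(z <- star_nbhd x) \sum_(y <- fset_set (neighbors z))
      p * (`|(v y - v z) + t * ((y == x)%:R - (z == x)%:R)| `^ (p - 2) *
      ((v y - v z) + t * ((y == x)%:R - (z == x)%:R))) * ((y == x)%:R - (z == x)%:R)).
  apply: is_derive_sum_seq => z; apply: is_derive_sum_seq => y.
  have := is_derive_scale_shift 0 1 (`|v y - v z| `^ p)
    (is_derive_affine_norm (v y - v z) ((y == x)%:R - (z == x)%:R) t p1).
  by under eq_fun do rewrite add0r mul1r; rewrite mul1r.
have beta0 : beta 0 = 1 by rewrite /beta subrr mulr0 addr0.
have [d d0 bpos] : exists2 d : R, 0 < d & forall s, `|s| < d -> 0 < beta s.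
  have cb : {for 0, continuous beta}.
    by apply/differentiable_continuous/derivable1_diffP; have [] := dbeta 0.
  have /nbhs_normP[d d0 hd] : \forall s \near 0, 0 < beta s.
    by apply: (cvgr_gt _ cb); rewrite beta0.
  by exists d => // s sd; apply: hd; rewrite /= sub0r normrN.
have dphi t : 0 < beta t -> is_derive t 1 phi
   (\sum_(z <- star_nbhd x) \sum_(y <- fset_set (neighbors z))
      p * (`|(v y - v z) + t * ((y == x)%:R - (z == x)%:R)| `^ (p - 2) *
      ((v y - v z) + t * ((y == x)%:R - (z == x)%:R))) * ((y == x)%:R - (z == x)%:R)
   - I * ((p / q) * beta t `^ (p / q - 1) *
    (mu (b * q) x * (q * (`|v x + t * 1| `^ (q - 2) * (v x + t * 1)) * 1)))).
  move=> bt; have h := is_derive1_comp (is_derive1_powR (p / q) bt) (dbeta t).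
  have := is_deriveB (is_deriveD (is_derive_cst I t 1) (deps t)) (is_deriveZ I h).
  by rewrite add0r.
have phi0 : phi 0 = 0.
  rewrite /phi beta0 powR1 mulr1 addrAC subrr add0r /eps big1// => z _.
  by rewrite big1// => y _; rewrite mul0r addr0 subrr.
have phi_ge0 s : `|s| < d -> 0 <= phi s.
  move=> /bpos bs.
  have vsE := energy_shift x s vE; have vsM := mass_shift x s mv.
  pose c : R := beta s `^ (- q^-1).
  have c0 : 0 < c by rewrite powR_gt0.
  have := vmin _ (D0Z p0 c0 (D0_delta x s Dv)).
  rewrite massZ// vsM -EFinM -/(beta s) /c -powRrM mulNr mulVf ?gt_eqF//.
  rewrite powR_inv1 ?(ltW bs)// mulVf ?gt_eqF// => /(_ erefl).
  rewrite energyZ ?powR_gt0// vsE -EFinM lee_fin -/(eps s) -powRrM mulNr powRN.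
  rewrite mulrC -ler_pdivrMr ?invr_gt0 ?powR_gt0// invrK => h.
  by rewrite /phi subr_ge0 (mulrC p).
have d0d : `|0 : R| < d by rewrite normr0.
have e2 := critical_point d0 (fun s sd => dphi s (bpos s sd)) phi0 phi_ge0.
move: e2; rewrite beta0 powR1 !mulr1 addr0.
have -> : \sum_(z <- star_nbhd x) \sum_(y <- fset_set (neighbors z))
      p * (`|(v y - v z) + 0 * ((y == x)%:R - (z == x)%:R)| `^ (p - 2) *
      ((v y - v z) + 0 * ((y == x)%:R - (z == x)%:R))) * ((y == x)%:R - (z == x)%:R) =
    - (2 * p * plaplacian p v x).
  rewrite -energy_gradient; apply: eq_bigr => z _; apply: eq_bigr => y _.
  by rewrite mul0r addr0.
have -> : `|v x| `^ (q - 2) * v x = v x `^ (q - 1).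
  rewrite ger0_norm//; have [->|vx] := eqVneq (v x) 0.
    by rewrite mulr0 powR0// gt_eqF//; lra.
  rewrite -{2}(powRr1 (v0 x)) -powRD ?vx ?implybT//.
  by congr (_ `^ _); lra.
move: (plaplacian p v x) (mu _ _) (v x `^ _) => D m V e.
have : 2 * p * (D + I / 2 * (m * V)) = 0.
  have -> : 2 * p * (D + I / 2 * (m * V)) =
     - (- (2 * p * D) - I * (p / q * (m * (q * V)))) by field; rewrite gt_eqF.
  by rewrite e oppr0.
by move/eqP; rewrite mulf_eq0 gt_eqF ?mulr_gt0//= => /eqP.
Qed.

End EulerLagrange.

(** * Aligned functions are Schwarz symmetric *)

Section Listing.
Variables (R : realType) (T : Type) (V : set T) (f : T -> R) (phi : nat -> T).
Hypotheses (f0 : forall t, 0 <= f t) (fin : forall v, 0 < v -> finite_set (V `&` [set x | f x = v]))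
  (phi_inj : injective phi) (phiV : range phi = V)
  (dec : forall m n, (m <= n)%N -> f (phi n) <= f (phi m)).

Lemma lists_decreasing_enum : lists_decreasing V f (f \o phi).
Proof.
split => [k|m n mn|v v0] /=; [exact: f0|exact: dec|].
have -> : V `&` [set x | f x = v] = phi @` [set k | f (phi k) = v].
  apply/seteqP; split => [x [Vx fx]|_ [k fk <-]].
    by move: Vx fx; rewrite -phiV => -[k _ <-] fk; exists k.
  by split; rewrite -?phiV.
by rewrite card_eq_sym; apply: inj_card_eq => k l _ _ /phi_inj.
Qed.

Lemma lists_decreasing_unique (g h : nat -> R) :
  lists_decreasing V f g -> lists_decreasing V f h -> g = h.
Proof.
(* at the first index where g2 < g1 = v, the value v is taken less often by g2 *)
have half (g1 g2 : nat -> R) (n : nat) : lists_decreasing V f g1 -> lists_decreasing V f g2 ->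
    (forall k, (k < n)%N -> g1 k = g2 k) -> g1 n <= g2 n.
  move=> [g10 g1d g1c] [g20 g2d g2c] eqn; rewrite leNgt; apply/negP => lt_n.
  pose v := g1 n.
  have v0 : 0 < v by apply: le_lt_trans lt_n.
  have fin1 : finite_set [set k | g1 k = v].
    by rewrite (eq_finite_set (g1c _ v0)); exact: fin.
  have sub : [set k | g2 k = v] `<=` [set k | g1 k = v] `\ n.
    move=> k /= gk; have kn : (k < n)%N.
      rewrite ltnNge; apply/negP => nk; have := g2d _ _ nk.
      by rewrite gk leNgt lt_n.
    by split => /=; [rewrite eqn|move=> kE; move: kn; rewrite kE ltnn].
  have [m c1] := fin1.
  have c2 : ([set k | g2 k = v] #= `I_m)%card.
    apply: card_eq_trans c1; apply: card_eq_trans (g2c _ v0) _.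
    by rewrite card_eq_sym; exact: g1c.
  have fin2 : finite_set [set k | g2 k = v] by exists m.
  have : (fset_set [set k | g2 k = v] `<` fset_set [set k | g1 k = v])%fset.
    rewrite fproperE; apply/andP; split.
      by apply/fsubsetP => k; rewrite !in_fset_set// !inE => /sub[].
    apply/negP => /fsubsetP/(_ n); rewrite !in_fset_set// !inE.
    by move=> /(_ erefl) /sub[_]; apply.
  by move/fproper_ltn_card; rewrite (card_fset_set c1) (card_fset_set c2) ltnn.
move=> Lg Lh; apply/funext => n; elim/ltn_ind: n => n IH; apply/eqP; rewrite eq_le.
by rewrite !half// => k kn; rewrite IH.
Qed.

(** A sequence enumerating [V] along which [f] decreases computes the decreasing
    rearrangement. *)
Lemma kth_value_enum k : kth_value V f k = f (phi k.-1).
Proof.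
rewrite /kth_value; case: xgetP => [g _ Lg|/(_ (f \o phi)) h].
  by rewrite (lists_decreasing_unique Lg lists_decreasing_enum).
by case: h; exact: lists_decreasing_enum.
Qed.

End Listing.

Section SchwarzSymmetric.
Variables (R : realType) (N : nat).
Implicit Types (u : lattice N -> R) (x y z a : lattice N).

(** The index, starting from 1, of a position in the decreasing listing; [h] is
    2 / <a, a> and [s] is the inner product with the axis. *)
Definition place (h s : int) : int := if s <= 0 then 1 - h * s else h * s.

Lemma directions_axis (e : 'rV[R]_N) : e \in directions R N ->
  exists a, axis a /\ e = (dot a a)%:~R^-1 *: embed R a.
Proof.
have emb (i : 'I_N) : embed R (delta_mx 0 i) = basis_vec R i.
  by apply/rowP => j; rewrite !mxE; case: (_ && _).
have pairs (ij : 'I_N * 'I_N) : ij \in [seq ij : 'I_N * 'I_N <- [seq (i, j) | i <- enum 'I_N, j <- enum 'I_N]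
               | (ij.1 < ij.2)%N] -> (ij.1 < ij.2)%N.
  by rewrite mem_filter => /andP[].
have n1 (i : 'I_N) : dot (delta_mx 0 i) (delta_mx 0 i) = 1 by rewrite dot_deltal mxE !eqxx.
have hB (i j : 'I_N) : (i < j)%N -> exists a, axis a /\
    2^-1 *: (basis_vec R i - basis_vec R j) = (dot a a)%:~R^-1 *: embed R a.
  move=> ij; exists (delta_mx 0 i - delta_mx 0 j); split; first by constructor 2; exists i, j.
  have -> : dot (delta_mx 0 i - delta_mx 0 j) (delta_mx 0 i - delta_mx 0 j) = 2.
    by rewrite !dotE !dot_deltal !mxE !eqxx !(ltn_ord_neq ij).
  by rewrite -!emb /embed map_mxB.
have hD (i j : 'I_N) : (i < j)%N -> exists a, axis a /\
    2^-1 *: (basis_vec R i + basis_vec R j) = (dot a a)%:~R^-1 *: embed R a.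
  move=> ij; exists (delta_mx 0 i + delta_mx 0 j); split; first by constructor 3; exists i, j.
  have -> : dot (delta_mx 0 i + delta_mx 0 j) (delta_mx 0 i + delta_mx 0 j) = 2.
    by rewrite !dotE !dot_deltal !mxE !eqxx !(ltn_ord_neq ij).
  by rewrite -!emb /embed map_mxD.
rewrite /directions !mem_cat => /orP[/mapP[i _ ->]|/orP[/mapP[[i j] /pairs /= ij_lt ->]|/mapP[[i j] /pairs /= ij_lt ->]]].
- exists (delta_mx 0 i); split; first by constructor 1; exists i.
  by rewrite n1 invr1 scale1r emb.
- exact: hB.
- exact: hD.
Qed.

Lemma axis_entry1 a : axis a -> exists l, a 0 l = 1.
Proof.
move=> [[i ->]|[i [j [ij ->]]]|[i [j [ij ->]]]]; exists i;
  by rewrite !mxE !eqxx ?(ltn_ord_neq ij).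
Qed.

(** An axis has an entry 1, so a real multiple of it with integer entries is an
    integer multiple. *)
Lemma line_classE (r : R) a x : axis a -> r != 0 ->
  line_class (r *: embed R a) x = [set y | exists c : int, y = x + c *: a].
Proof.
move=> ra r0; apply/seteqP; split => y /= [t h].
  have [l al] := axis_entry1 ra.
  exists (y 0 l - x 0 l); apply/rowP => i; rewrite !mxE.
  have hi : (x 0 i - y 0 i)%:~R = t * (r * (a 0 i)%:~R) :> R.
    by have /rowP/(_ i) := h; rewrite !mxE rmorphB.
  have hl : (x 0 l - y 0 l)%:~R = t * r :> R.
    by have /rowP/(_ l) := h; rewrite !mxE al rmorphB mulr1.
  have /eqP : (x 0 i - y 0 i)%:~R = ((x 0 l - y 0 l) * a 0 i)%:~R :> R.
    by rewrite hi intrM hl mulrA.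
  by rewrite eqr_int => /eqP; move: (x 0 i) (y 0 i) (x 0 l) (y 0 l) (a 0 i) => *; lia.
exists (- t%:~R / r); rewrite h; apply/rowP => i.
by rewrite !mxE rmorphD rmorphM/= mulrA divfK//; ring.
Qed.

Lemma inner_embed (r : R) a y : inner (r *: embed R a) (embed R y) = r * (dot a y)%:~R.
Proof.
rewrite /inner /dot rmorph_sum mulr_sumr; apply: eq_bigr => i _.
by rewrite !mxE rmorphM mulrA.
Qed.

Lemma place_surj (h n s0 : int) (k : nat) : n = 1 /\ h = 2 \/ n = 2 /\ h = 1 ->
  exists c : int, place h (s0 + c * n) = k.+1%:Z.
Proof.
have [m sm] : exists m : int, s0 = 2 * m \/ s0 = 2 * m + 1.
  by exists (s0 %/ 2)%Z; lia.
have [j kj] : exists j : nat, k = (2 * j)%N \/ k = (2 * j + 1)%N.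
  by exists (k %/ 2)%N; lia.
move=> [[-> ->]|[-> ->]]; case: kj => ->; rewrite /place.
- by exists (- j%:Z - s0); case: ifP; lia.
- by exists (j%:Z + 1 - s0); case: ifP; lia.
- case: sm => ->; first by exists (- j%:Z - m); case: ifP; lia.
  by exists (j%:Z - m); case: ifP; lia.
- case: sm => ->; first by exists (j%:Z + 1 - m); case: ifP; lia.
  by exists (- j%:Z - 1 - m); case: ifP; lia.
Qed.

Lemma place_inj (h n s0 c c' : int) : n = 1 /\ h = 2 \/ n = 2 /\ h = 1 ->
  place h (s0 + c * n) = place h (s0 + c' * n) -> c = c'.
Proof. by rewrite /place => -[[-> ->]|[-> ->]]; do 2 case: ifP; lia. Qed.

Lemma place_key (h n s0 c c' : int) : n = 1 /\ h = 2 \/ n = 2 /\ h = 1 ->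
  place h (s0 + c * n) < place h (s0 + c' * n) -> key (s0 + c * n) < key (s0 + c' * n).
Proof. by rewrite /place /key => -[[-> ->]|[-> ->]]; do 2 case: ifP; lia. Qed.

Lemma place_gt0 (h s : int) : 0 < h -> 0 < place h s.
Proof. by rewrite /place; case: ifP; nia. Qed.

(** The points of a line are enumerated by their place, and an aligned function
    decreases along this enumeration: it is its own rearrangement. *)
Lemma one_step_aligned u e : C0plus u -> aligned u -> e \in directions R N -> one_step e u = u.
Proof.
move=> [u0 uf] au /directions_axis[a [ra ->]]; apply/funext => x.
pose n := dot a a; pose h : int := if n == 1 then 2 else 1.
have nh : n = 1 /\ h = 2 \/ n = 2 /\ h = 1.
  by rewrite /h /n; case: (axis_norm ra) => ->; [left|right].
have h0 : 0 < h by case: nh => -[_ ->].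
have nR : n%:~R != 0 :> R by case: nh => -[-> _]; rewrite intr_eq0.
have hn : 2 * n%:~R^-1 = h%:~R :> R.
  by case: nh => -[-> ->]; rewrite ?invr1 ?mulr1// mulfV.
have ds c : dot a (x + c *: a) = dot a x + c * n by rewrite !dotE.
have /boolp.choice[c cE] : forall k : nat, exists c : int, place h (dot a x + c * n) = k.+1%:Z.
  by move=> k; exact: place_surj.
pose phi k : lattice N := x + c k *: a.
have phi_inj : injective phi.
  move=> k l /(congr1 (dot a)); rewrite !ds => dkl.
  by have := cE k; rewrite dkl cE => -[].
have rphi : range phi = line_class (n%:~R^-1 *: embed R a) x.
  rewrite line_classE ?invr_eq0//; apply/seteqP; split => [_ [k _ <-]|_ [d ->]].
    by exists (c k).
  have p0 := place_gt0 (dot a x + d * n) h0.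
  exists (`|place h (dot a x + d * n)|%N.-1) => //; rewrite /phi; congr (_ + _ *: _).
  by apply: (place_inj nh (s0 := dot a x)); rewrite cE; lia.
rewrite /one_step /star (@kth_value_enum _ _ _ _ phi)//.
- have -> : Num.truncn (if inner (n%:~R^-1 *: embed R a) (embed R x) <= 0
      then 1 - 2 * inner (n%:~R^-1 *: embed R a) (embed R x)
      else 2 * inner (n%:~R^-1 *: embed R a) (embed R x)) = `|place h (dot a x)|%N.
    rewrite inner_embed mulrA hn pmulr_rle0 ?invr_gt0 ?lerz0; last first.
      by case: nh => -[-> _]; rewrite ltr0z.
    have p0 := place_gt0 (dot a x) h0.
    have pE : (place h (dot a x))%:~R = `|place h (dot a x)|%N%:R :> R.
      by rewrite natr_absz gtr0_norm.
    rewrite -[RHS](natrK (R := R)) -pE /place; congr Num.truncn.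
    by case: ifP => _; rewrite ?rmorphB/= rmorphM.
  suff -> : phi (`|place h (dot a x)|%N.-1) = x by [].
  have p0 := place_gt0 (dot a x) h0.
  rewrite /phi (_ : c _ = 0) ?scale0r ?addr0//.
  by apply: (place_inj nh (s0 := dot a x)); rewrite cE mul0r addr0; lia.
- move=> v v0; apply: (@sub_finite_set _ _ [set y | v / 2 < u y]).
    by move=> y [_ /= ->]; lra.
  by apply: uf; lra.
- move=> k l; rewrite leq_eqVlt => /orP[/eqP ->//|kl].
  have -> : phi l = phi k + (c l - c k) *: a.
    by rewrite /phi -addrA -scalerDl [c k + _]addrC subrK.
  apply: au => //; rewrite dotDr dotZr [dot a (phi k)]ds -/n -addrA -mulrDl [c k + _]addrC subrK.
  by apply: (place_key nh); rewrite !cE; lia.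
Qed.

Lemma schwarz_symmetric_aligned u : (0 < N)%N -> C0plus u -> aligned u -> schwarz_symmetric u.
Proof.
move=> N0 cu au; split => //.
have it k : iter_rearr k u = u.
  elim: k => //= k ->; apply: one_step_aligned => //; apply: mem_nth.
  by rewrite ltn_mod /directions size_cat size_map size_enum_ord addn_gt0 N0.
apply/funext => x; rewrite /schwarz_rearr; under eq_fun do rewrite it.
by rewrite lim_cst.
Qed.

End SchwarzSymmetric.

(** * Positivity and conclusion *)

Section Positivity.
Variables (R : realType) (N : nat).
Implicit Types (u v : lattice N -> R) (x y : lattice N).

Lemma walk_invariant (P : lattice N -> Prop) x y n :
  (forall x y, neighbor x y -> P x -> P y) -> walk x y n -> P x <-> P y.
Proof.
move=> Pn [s [ps <- _]] {y n}; elim: s x ps => //= y s IH x /andP[xy /IH <-].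
by split; apply: Pn => //; rewrite neighborC.
Qed.

Lemma lattice_invariant (P : lattice N -> Prop) x y :
  (forall x y, neighbor x y -> P x -> P y) -> P x -> P y.
Proof.
move=> Pn; have to0 z : P z <-> P 0.
  apply: (walk_invariant Pn (n := `|l1 z|%N)); apply: l1_walk.
  by rewrite gez0_abs// sumr_ge0.
by rewrite !to0.
Qed.

Lemma plaplacian_eq0 p u x : (forall y, 0 <= u y) -> u x = 0 -> plaplacian p u x = 0 ->
  forall y, neighbor x y -> u y = 0.
Proof.
move=> u0 ux; rewrite plaplacianE => /eqP.
rewrite big_seq psumr_eq0 => [/allP h y xy|y _]; last first.
  by rewrite ux subr0 mulr_ge0 ?powR_ge0.
have yn : y \in fset_set (neighbors x) by rewrite mem_nbhd.
have := h y yn; rewrite yn/= ux subr0 mulf_eq0 => /orP[|/eqP//].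
by rewrite powR_eq0 normr_eq0 => /andP[/eqP].
Qed.

(** Strong maximum principle: at a zero of a nonnegative solution the p-Laplacian is a
    sum of nonnegative terms, so the zeros propagate to the neighbors and then to
    the whole connected lattice. *)
Lemma solution_gt0 p q (k : R) (m : lattice N -> R) u : 1 < q -> (forall x, 0 <= u x) ->
  (forall x, plaplacian p u x + k * (m x * u x `^ (q - 1)) = 0) ->
  (exists x, u x != 0) -> forall x, 0 < u x.
Proof.
move=> q1 u0 ueq [y uy] x; rewrite lt_neqAle u0 andbT eq_sym; apply/negP => /eqP ux.
move/eqP: uy; apply; apply: (@lattice_invariant (fun x => u x = 0) x) => // {x ux} x z xz ux.
apply: (@plaplacian_eq0 p u x) => //.
by have := ueq x; rewrite ux powR0 ?mulr0 ?addr0// gt_eqF// subr_gt0.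
Qed.

Lemma plaplacianZ p (c : R) u x : 0 < c ->
  plaplacian p (fun y => c * u y) x = c `^ (p - 1) * plaplacian p u x.
Proof.
move=> c0; rewrite !plaplacianE mulr_sumr; apply: eq_bigr => y _.
rewrite -mulrBr normrM gtr0_norm// powRM ?(ltW c0)// mulrACA; congr (_ * _).
rewrite -[X in _ * X](powRr1 (ltW c0)) -powRD ?(gt_eqF c0) ?implybT//.
by congr (_ `^ _); lra.
Qed.

Lemma mass0 b q u : 0 < q -> (forall x, u x = 0) -> mass b q u = 0%E.
Proof.
move=> q0 u0; apply: esum1 => x _.
by rewrite u0 normr0 powR0 ?mulr0// gt_eqF.
Qed.

End Positivity.

Theorem corollary1p7 (R : realType) (N : nat) (p b q : R)
  (hN : (1 <= N)%N)
  (hp1 : 1 < p) (hpN : p < N%:R)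
  (hb1 : -1 <= b) (hb0 : b <= 0)
  (hq : qstar N p b < q) (hqstar : 1 < qstar N p b) :
  exists u : lattice N -> R,
    [/\ forall x, 0 < u x,
        schwarz_symmetric u
      & ground_state_solution p b q u].
Proof.
have q1 : 1 < q := lt_trans hqstar hq.
have q0 : 0 < q by lra.
have p0 : 0 < p by lra.
have pq : p < q := p_lt_q hp1 hpN hb1 hb0 hq.
have [v [I [I0 vmin [v0 vfin] av [vE vcmp]]]] := exists_minimizer hN hp1 hpN hb0 hq hqstar.
have [[Dv /(lnorm1P b v q0) mv] _] := vmin.
have EL := euler_lagrange hp1 q1 v0 Dv mv vE vcmp.
have nz : exists x, v x != 0.
  apply/not_existsP => h; have : mass b q v = 0%E.
    by apply: mass0 => // x; apply/eqP; have /negP := h x; rewrite negbK.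
  by rewrite mv => /eqP; rewrite onee_eq0.
have vpos := solution_gt0 q1 v0 EL nz.
(* the two sides of the equation have degrees p - 1 and q - 1; c turns the
   multiplier I / 2 into 1 *)
pose c : R := (I / 2) `^ (q - p)^-1.
have c0 : 0 < c by rewrite powR_gt0 ?divr_gt0.
pose u x := c * v x.
have cu : C0plus u.
  split=> [x|t t0]; first by rewrite mulr_ge0// ltW.
  have tc : 0 < t / c by rewrite divr_gt0.
  apply: sub_finite_set (vfin _ tc) => x /=.
  by rewrite ltr_pdivrMr// mulrC.
exists u; split.
- by move=> x; rewrite mulr_gt0.
- exact: schwarz_symmetric_aligned hN cu (alignedZ (ltW c0) av).
split; last by exists c => //; exists v.
split; first exact: D0Z.
move=> x; rewrite plaplacianZ// (mulrC q b) powRM ?(ltW c0)//.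
have -> : c `^ (q - 1) = c `^ (p - 1) * (I / 2).
  have -> : q - 1 = (p - 1) + (q - p) by lra.
  rewrite powRD ?(gt_eqF c0) ?implybT//; congr (_ * _).
  rewrite /c -powRrM mulVf ?powRr1 ?divr_ge0 ?(ltW I0)//.
  by rewrite gt_eqF// subr_gt0.
rewrite (_ : _ + _ = c `^ (p - 1) * (plaplacian p v x + I / 2 * (mu (b * q) x * v x `^ (q - 1)))); last by ring.
by rewrite EL mulr0.
Qed.
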